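(* Let $X$, $d$, $r$, $\mathcal{L}$ and the refined data $\mathfrak{h}=(\mathcal{L},V_{X_1},V_{X_2},V_{X_3})$ be as described in the context, with spaces $K_{il}$, and with $b_0<\dots<b_r$ and $b'_0<\dots<b'_r$ the orders of vanishing of $V_{X_2}$ at $A$ and at $B$ respectively. The following statements are equivalent: 1. $\mathfrak{h}$ has a unique exact extension. 2. $\dim K_{il}=r+1$ for all integers $i,l\ge 0$ and $j,k\in\{1,\dots,r\}$ such that $i+l\leq d$, $b_{j-1}<i\leq b_{j}$, $b'_{k-1}<l\leq b'_{k}$ and $j+k\leq r+1$. 3. $\mathfrak{h}$ has a unique extension.
   Context: Curves are projective over an algebraically closed field $k$. $X$ is the union of three smooth connected curves $X_1,X_2,X_3$, where $X_1,X_2$ meet transversally at a single point $A$, $X_2,X_3$ meet transversally at a single point $B\neq A$, and $X_1\cap X_3=\emptyset$. For a union $Y$ of some components of $X$, $Y^c$ is the union of the other components. Fix integers $d,r\ge 0$ and an invertible sheaf $\mathcal{L}$ on $X$ of degree $d$ on $X_1$ and degree $0$ on $X_2$ and $X_3$. For integers $i,l\ge 0$ with $i+l\le d$, and $\underline{d}=(i,d-i-l,l)$, let $\mathcal{L}_{\underline{d}}=\mathcal{L}_{il}$ be the invertible sheaf on $X$ with restrictions $\mathcal{L}|_{X_1}(-(d-i)A)$, $\mathcal{L}|_{X_2}((d-i)A-lB)$, $\mathcal{L}|_{X_3}(lB)$; it has multidegree $\underline{d}$. Put $\mathcal{L}_{X_1}=\mathcal{L}_{(d,0,0)}$, $\mathcal{L}_{X_2}=\mathcal{L}_{(0,d,0)}$,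 $\mathcal{L}_{X_3}=\mathcal{L}_{(0,0,d)}$. Maps. For $\underline{d}=(i,d-i-l,l)\ge\underline 0$ and $q\in\{1,2,3\}$ let $\widetilde{\underline{d}}$ be $(i-1,d-i-l+1,l)$ if $q=1$, $(i+1,d-i-l-2,l+1)$ if $q=2$, $(i,d-i-l+1,l-1)$ if $q=3$. Whenever $\widetilde{\underline{d}}\ge\underline 0$ there are natural maps $\varphi_{\underline{d},\widetilde{\underline{d}}}:\mathcal{L}_{\underline{d}}\to\mathcal{L}_{\underline{d}}|_{X_q^c}=\mathcal{L}_{\widetilde{\underline{d}}}|_{X_q^c}(-X_q\cap X_q^c)\hookrightarrow\mathcal{L}_{\widetilde{\underline{d}}}$ and $\varphi_{\widetilde{\underline{d}},\underline{d}}:\mathcal{L}_{\widetilde{\underline{d}}}\to\mathcal{L}_{\widetilde{\underline{d}}}|_{X_q}=\mathcal{L}_{\underline{d}}|_{X_q}(-X_q\cap X_q^c)\hookrightarrow\mathcal{L}_{\underline{d}}$ (restriction followed by inclusion, i.e. extension by zero); the same symbols denote the induced maps on global sections. For a subspace $V\subseteq H^0(X,\mathcal{L}_{\underline{d}})$ and a subcurve $Y$, $V^{Y,0}$ is the subspace of sections in $V$ vanishing on $Y$. Refined data $\mathfrak{h}$. $V_{X_q}\subseteq H^0(X,\mathcal{L}_{X_q})$ ($q=1,2,3$) are subspaces of dimension $r+1$ which are linked: the compositions of the maps $\varphi$ along the chains of multidegrees $(d,0,0),(d-1,1,0),\dots,(0,d,0)$ and $(0,d,0),(0,d-1,1),\dots,(0,0,d)$,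 in both directions, map $V_{X_1}$ into $V_{X_2}$, $V_{X_2}$ into $V_{X_1}$, $V_{X_2}$ into $V_{X_3}$ and $V_{X_3}$ into $V_{X_2}$. Restriction to $X_q$ is injective on $V_{X_q}$, and $V_{X_q}$ is also regarded as a linear series in $H^0(X_q,\mathcal{L}_{X_q}|_{X_q})$; for an effective divisor $D$ supported at the nodes on $X_q$, $V_{X_q}(-D)$ is the subspace of sections of this linear series vanishing along $D$. Let $a_0<\dots<a_r$ be the orders of vanishing of $V_{X_1}$ at $A$, $b_0<\dots<b_r$ and $b'_0<\dots<b'_r$ those of $V_{X_2}$ at $A$ and at $B$, and $c_0<\dots<c_r$ those of $V_{X_3}$ at $B$. The associated Eisenbud–Harris limit linear series is assumed refined: $a_{r-j}+b_j=d$ and $b'_j+c_{r-j}=d$ for $0\le j\le r$. Kernels. Since $\mathcal{L}_{il}|_{X_1}=\mathcal{L}_{X_1}|_{X_1}(-(d-i)A)$, $\mathcal{L}_{il}|_{X_2}=\mathcal{L}_{X_2}|_{X_2}(-iA-lB)$, $\mathcal{L}_{il}|_{X_3}=\mathcal{L}_{X_3}|_{X_3}(-(d-l)B)$, one defines $K_{il}\subseteq H^0(X,\mathcal{L}_{il})$ (for $i,l\ge0$, $i+l\le d$) as the space of sections $s$ with $s|_{X_1}\in V_{X_1}(-(d-i)A)$, $s|_{X_2}\in V_{X_2}(-iA-lB)$ and $s|_{X_3}\in V_{X_3}(-(d-l)B)$. Equivalently, $K_{il}$ is the kernel of the evaluation (gluing) map $V_{X_1}(-(d-i)A)\oplus V_{X_2}(-iA-lB)\oplus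 V_{X_3}(-(d-l)B)\to k\oplus k$ at $A$ and $B$. Limit linear series and extensions. A limit linear series on $X$ of degree $d$ and dimension $r$ with sheaf $\mathcal{L}$ is a collection of subspaces $V_{\underline{d}}\subseteq H^0(X,\mathcal{L}_{\underline{d}})$ of dimension $r+1$, one for each $\underline{d}=(i,d-i-l,l)\ge\underline 0$, such that $\varphi_{\underline{d},\widetilde{\underline{d}}}(V_{\underline{d}})\subseteq V_{\widetilde{\underline{d}}}$ and $\varphi_{\widetilde{\underline{d}},\underline{d}}(V_{\widetilde{\underline{d}}})\subseteq V_{\underline{d}}$ for all $\underline{d}$ and $q$ with $\widetilde{\underline{d}}\ge\underline 0$. It is exact if always $\varphi_{\underline{d},\widetilde{\underline{d}}}(V_{\underline{d}})=V_{\widetilde{\underline{d}}}^{X_q,0}$ and $\varphi_{\widetilde{\underline{d}},\underline{d}}(V_{\widetilde{\underline{d}}})=V_{\underline{d}}^{X_q^c,0}$. An extension of $\mathfrak{h}$ is a limit linear series with sheaf $\mathcal{L}$ such that $V_{(d,0,0)}=V_{X_1}$, $V_{(0,d,0)}=V_{X_2}$, $V_{(0,0,d)}=V_{X_3}$; an exact extension is an extension which is exact. *)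

(* Defs.v *)
From HB Require Import structures.
From mathcomp Require Import all_boot all_order all_algebra.
From mathcomp Require Import boolp classical_sets.
From mathcomp Require Import freeg.

Set Implicit Arguments.
Unset Strict Implicit.
Unset Printing Implicit Defensive.

Import Order.TTheory GRing.Theory Num.Theory.
Local Open Scope classical_set_scope.
Local Open Scope ring_scope.

(** * Smooth connected projective curves

  A smooth connected projective curve over the algebraically closed field [k]
  is given by its function field: a finitely generated field extension of [k]
  of transcendence degree one.  Its closed points are the normalized discrete
  valuations of the function field that are trivial on [k]. *)

#[short(type="fieldAlgType")]
HB.structure Definition FieldAlgebra (k : nzRingType) :=
  {K of GRing.Field K & GRing.Algebra k K}.

Definition finitely_generated (k : fieldType) (K : fieldAlgType k) : Prop :=
  exists s : seq K, forall S : {pred K}, divring_closed S ->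
    (forall c : k, c%:A \in S) -> {subset s <= S} -> forall x : K, x \in S.

Definition algebraically_dependent (k : fieldType) (K : fieldAlgType k)
    (x y : K) : Prop :=
  exists2 p : {poly {poly k}}, p != 0 & (map_poly (horner_alg x) p).[y] = 0.

Definition transcendental (k : fieldType) (K : fieldAlgType k) (x : K) : Prop :=
  forall p : {poly k}, horner_alg x p = 0 -> p = 0.

Definition trdeg_one (k : fieldType) (K : fieldAlgType k) : Prop :=
  (exists x : K, transcendental x) /\
  (forall x y : K, algebraically_dependent x y).

Record curve (k : closedFieldType) := Curve {
  fun_field :> fieldAlgType k;
  curve_fg : finitely_generated fun_field;
  curve_trdeg : trdeg_one fun_field }.

(* [ord P 0] is a junk value, fixed to [0] so that a point is determined by its
   valuation. *)
Record point (k : closedFieldType) (X : curve k) := Point {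
  ord : X -> int;
  ord0 : ord 0 = 0;
  ordM : forall f g : X, f != 0 -> g != 0 -> ord (f * g) = ord f + ord g;
  ordD : forall f g : X, f != 0 -> g != 0 -> f + g != 0 ->
    Num.min (ord f) (ord g) <= ord (f + g);
  ord_const : forall c : k, c != 0 -> ord c%:A = 0;
  ord_unif : exists2 t : X, t != 0 & ord t = 1 }.

HB.instance Definition _ (k : closedFieldType) (X : curve k) :=
  gen_eqMixin (point X).
HB.instance Definition _ (k : closedFieldType) (X : curve k) :=
  gen_choiceMixin (point X).

Notation divisor X := {freeg (point X)}.

(* [ord P f >= n], with the convention [ord P 0 = +oo] *)
Definition ord_ge (k : closedFieldType) (X : curve k) (P : point X) (n : int)
    (f : X) : bool :=
  (f == 0) || (n <= ord P f).

(* H^0(X, O(D)) *)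
Definition H0 (k : closedFieldType) (X : curve k) (D : divisor X) : set X :=
  [set f | forall P : point X, ord_ge P (- coeff P D) f].

(* For a linear series [W] in H^0(X, O(D)) and an effective divisor [E]: the
   subspace W(-E) of the sections vanishing along [E]. *)
Definition vanishing_along (k : closedFieldType) (X : curve k) (D : divisor X)
    (W : set X) (E : divisor X) : set X :=
  W `&` H0 (D - E).

(* [s] is the increasing sequence of the orders of vanishing at [P] of the
   nonzero sections in the linear series [W] in H^0(X, O(D)). *)
Definition vanishing_orders (k : closedFieldType) (X : curve k) (D : divisor X)
    (W : set X) (P : point X) (s : seq nat) : Prop :=
  sorted ltn s /\
  forall n : nat, n \in s <->
    exists f : X, [/\ W f, f != 0 & ord P f + coeff P D = n%:Z].

Definition has_dim (k : fieldType) (E : lmodType k) (V : set E) (n : nat) :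
    Prop :=
  exists e : 'I_n -> E,
    (forall c : 'I_n -> k, \sum_i c i *: e i = 0 -> forall i, c i = 0) /\
    V = [set v | exists c : 'I_n -> k, v = \sum_i c i *: e i].

(** * The nodal curve X and its invertible sheaves *)

(* The node A is the point [A1] of X_1 glued to the point [A2] of X_2; the node
   B is the point [B2] of X_2 glued to the point [B3] of X_3. *)
Record chain (k : closedFieldType) := Chain {
  X1 : curve k;
  X2 : curve k;
  X3 : curve k;
  A1 : point X1;
  A2 : point X2;
  B2 : point X2;
  B3 : point X3;
  A2_neq_B2 : A2 <> B2 }.

(* An isomorphism from the fibre of O(D) at [P] to the fibre of O(D') at [P'],
   given by a local generator of O(D) at [P] and a local generator of O(D') at
   [P'] whose values in the fibres correspond to each other. *)
Record gluing (k : closedFieldType) (X X' : curve k) (P : point X)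
    (P' : point X') (D : divisor X) (D' : divisor X') := Gluing {
  frame : X;
  frame' : X';
  frame_neq0 : frame != 0;
  frame_ord : ord P frame = - coeff P D;
  frame'_neq0 : frame' != 0;
  frame'_ord : ord P' frame' = - coeff P' D' }.

(* The values of [f] at [P] and [f'] at [P'] correspond to each other. *)
Definition glued (k : closedFieldType) (X X' : curve k) (P : point X)
    (P' : point X') (D : divisor X) (D' : divisor X')
    (g : gluing P P' D D') (f : X) (f' : X') : Prop :=
  exists c : k, ord_ge P (1 - coeff P D) (f - c *: frame g) /\
                ord_ge P' (1 - coeff P' D') (f' - c *: frame' g).

(* An invertible sheaf on X amounts to invertible sheaves on X_1, X_2 and X_3
   together with isomorphisms of their fibres at the nodes. *)
Record line_bundle (k : closedFieldType) (X : chain k) := LineBundle {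
  div1 : divisor (X1 X);
  div2 : divisor (X2 X);
  div3 : divisor (X3 X);
  glueA : gluing (A1 X) (A2 X) div1 div2;
  glueB : gluing (B2 X) (B3 X) div2 div3 }.

(* Every sheaf used below is a subsheaf of the constant sheaves on the three
   components, so all its sections live in one common space. *)
Notation sections X := (X1 X * X2 X * X3 X)%type.

Definition H0X (k : closedFieldType) (X : chain k) (L : line_bundle X) :
    set (sections X) :=
  [set s | [/\ H0 (div1 L) s.1.1, H0 (div2 L) s.1.2, H0 (div3 L) s.2,
               glued (glueA L) s.1.1 s.1.2 & glued (glueB L) s.1.2 s.2]].

Definition q1 : 'I_3 := @Ordinal 3 0 isT.
Definition q2 : 'I_3 := @Ordinal 3 1 isT.
Definition q3 : 'I_3 := @Ordinal 3 2 isT.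

(* Restriction to the subcurve [Y] followed by extension by zero.  The maps
   phi_{d,d~} and phi_{d~,d} of index [q] are [restr (~: [set q])] and
   [restr [set q]]. *)
Definition restr (k : closedFieldType) (X : chain k) (Y : {set 'I_3})
    (s : sections X) : sections X :=
  (if q1 \in Y then s.1.1 else 0,
   if q2 \in Y then s.1.2 else 0,
   if q3 \in Y then s.2 else 0).

(* V^{Y,0} *)
Definition vanishing_on (k : closedFieldType) (X : chain k)
    (V : set (sections X)) (Y : {set 'I_3}) : set (sections X) :=
  [set s | [/\ V s, q1 \in Y -> s.1.1 = 0, q2 \in Y -> s.1.2 = 0
             & q3 \in Y -> s.2 = 0]].

(** * Twists

  Families indexed by the multidegrees (i, d-i-l, l) are indexed by [i] and [l];
  only the values with [i + l <= d] matter. *)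

(* [Lt i l] is the invertible sheaf of multidegree (i, d-i-l, l).  The last two
   conditions make the identifications of restrictions that define the maps phi
   the identity on rational functions: the gluing at A is the same for the
   multidegrees that agree on X_1 (those related by q = 3), and the gluing at B
   for those that agree on X_3 (those related by q = 1). *)
Definition is_twist_family (k : closedFieldType) (X : chain k) (d : nat)
    (L : line_bundle X) (Lt : nat -> nat -> line_bundle X) : Prop :=
  [/\ Lt d 0%N = L,
      forall i l : nat, (i + l <= d)%N ->
        [/\ div1 (Lt i l) = div1 L - << (d - i)%N%:Z *g A1 X >>,
            div2 (Lt i l) =
              div2 L + << (d - i)%N%:Z *g A2 X >> - << l%:Z *g B2 X >>
          & div3 (Lt i l) = div3 L + << l%:Z *g B3 X >>],
      forall i l l' : nat, (i + l <= d)%N -> (i + l' <= d)%N ->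
        forall f f', glued (glueA (Lt i l)) f f' <->
                     glued (glueA (Lt i l')) f f'
    & forall i i' l : nat, (i + l <= d)%N -> (i' + l <= d)%N ->
        forall f f', glued (glueB (Lt i l)) f f' <->
                     glued (glueB (Lt i' l)) f f'].

(* (i', d-i'-l', l') is the multidegree d~ obtained from (i, d-i-l, l) and [q],
   both being nonnegative. *)
Definition tilde (d : nat) (q : 'I_3) (i l i' l' : nat) : Prop :=
  [/\ (i + l <= d)%N, (i' + l' <= d)%N
    & if q == q1 then i = i'.+1 /\ l' = l
      else if q == q2 then i' = i.+1 /\ l' = l.+1
      else i' = i /\ l = l'.+1].

(** * The data h *)

(* Along the chain from (d,0,0) to (0,d,0) every step is given by q = 1, and
   along the chain from (0,0,d) to (0,d,0) every step is given by q = 3. *)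
Definition linked (k : closedFieldType) (X : chain k) (d : nat)
    (V1 V2 V3 : set (sections X)) : Prop :=
  [/\ iter d (restr (~: [set q1])) @` V1 `<=` V2,
      iter d (restr [set q1]) @` V2 `<=` V1,
      iter d (restr [set q3]) @` V2 `<=` V3
    & iter d (restr (~: [set q3])) @` V3 `<=` V2].

Definition is_data (k : closedFieldType) (X : chain k) (d r : nat)
    (Lt : nat -> nat -> line_bundle X) (V1 V2 V3 : set (sections X)) : Prop :=
  [/\ [/\ V1 `<=` H0X (Lt d 0%N), V2 `<=` H0X (Lt 0%N 0%N)
        & V3 `<=` H0X (Lt 0%N d)],
      [/\ has_dim V1 r.+1, has_dim V2 r.+1 & has_dim V3 r.+1],
      linked d V1 V2 V3
    & [/\ vanishing_on V1 [set q1] `<=` [set 0],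
          vanishing_on V2 [set q2] `<=` [set 0]
        & vanishing_on V3 [set q3] `<=` [set 0]]].

(* The spaces V_{X_q}, regarded as linear series on X_q. *)
Definition series1 (k : closedFieldType) (X : chain k)
    (V : set (sections X)) : set (X1 X) := (fun s => s.1.1) @` V.
Definition series2 (k : closedFieldType) (X : chain k)
    (V : set (sections X)) : set (X2 X) := (fun s => s.1.2) @` V.
Definition series3 (k : closedFieldType) (X : chain k)
    (V : set (sections X)) : set (X3 X) := (fun s => s.2) @` V.

Definition is_refined (k : closedFieldType) (X : chain k) (d r : nat)
    (Lt : nat -> nat -> line_bundle X) (V1 V2 V3 : set (sections X))
    (a b b' c : r.+1.-tuple nat) : Prop :=
  [/\ vanishing_orders (div1 (Lt d 0%N)) (series1 V1) (A1 X) a,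
      vanishing_orders (div2 (Lt 0%N 0%N)) (series2 V2) (A2 X) b,
      vanishing_orders (div2 (Lt 0%N 0%N)) (series2 V2) (B2 X) b',
      vanishing_orders (div3 (Lt 0%N d)) (series3 V3) (B3 X) c
    & forall j : 'I_r.+1,
        (tnth a (rev_ord j) + tnth b j = d)%N /\
        (tnth b' j + tnth c (rev_ord j) = d)%N].

Definition Kspace (k : closedFieldType) (X : chain k) (d : nat)
    (Lt : nat -> nat -> line_bundle X) (V1 V2 V3 : set (sections X))
    (i l : nat) : set (sections X) :=
  [set s | [/\ H0X (Lt i l) s,
      vanishing_along (div1 (Lt d 0%N)) (series1 V1)
        << (d - i)%N%:Z *g A1 X >> s.1.1,
      vanishing_along (div2 (Lt 0%N 0%N)) (series2 V2)
        (<< i%:Z *g A2 X >> + << l%:Z *g B2 X >>) s.1.2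
    & vanishing_along (div3 (Lt 0%N d)) (series3 V3)
        << (d - l)%N%:Z *g B3 X >> s.2]].

(** * Limit linear series and extensions *)

Definition is_limit_linear_series (k : closedFieldType) (X : chain k)
    (d r : nat) (Lt : nat -> nat -> line_bundle X)
    (V : nat -> nat -> set (sections X)) : Prop :=
  (forall i l : nat, (i + l <= d)%N ->
     V i l `<=` H0X (Lt i l) /\ has_dim (V i l) r.+1) /\
  (forall (q : 'I_3) (i l i' l' : nat), tilde d q i l i' l' ->
     restr (~: [set q]) @` V i l `<=` V i' l' /\
     restr [set q] @` V i' l' `<=` V i l).

Definition is_exact (k : closedFieldType) (X : chain k) (d : nat)
    (V : nat -> nat -> set (sections X)) : Prop :=
  forall (q : 'I_3) (i l i' l' : nat), tilde d q i l i' l' ->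
    restr (~: [set q]) @` V i l = vanishing_on (V i' l') [set q] /\
    restr [set q] @` V i' l' = vanishing_on (V i l) (~: [set q]).

Definition is_extension (k : closedFieldType) (X : chain k) (d r : nat)
    (Lt : nat -> nat -> line_bundle X) (V1 V2 V3 : set (sections X))
    (V : nat -> nat -> set (sections X)) : Prop :=
  is_limit_linear_series d r Lt V /\
  [/\ V d 0%N = V1, V 0%N 0%N = V2 & V 0%N d = V3].

Definition is_exact_extension (k : closedFieldType) (X : chain k) (d r : nat)
    (Lt : nat -> nat -> line_bundle X) (V1 V2 V3 : set (sections X))
    (V : nat -> nat -> set (sections X)) : Prop :=
  is_extension d r Lt V1 V2 V3 V /\ is_exact d V.

(* There is exactly one family satisfying [P], up to the irrelevant values
   outside [i + l <= d]. *)
Definition exists_unique_family (T : Type) (d : nat)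
    (P : (nat -> nat -> T) -> Prop) : Prop :=
  exists V, P V /\
    forall V', P V' -> forall i l : nat, (i + l <= d)%N -> V' i l = V i l.

(* Main.v *)
Require Import Defs.
From HB Require Import structures.
From mathcomp Require Import all_boot all_order all_algebra.
From mathcomp Require Import boolp classical_sets.
From mathcomp Require Import freeg zify.

Set Implicit Arguments.
Unset Strict Implicit.
Unset Printing Implicit Defensive.

Import Order.TTheory GRing.Theory Num.Theory.
Local Open Scope classical_set_scope.
Local Open Scope ring_scope.

(** The proof makes the three linear series explicit in suitable bases.

  Two filtrations of a finite-dimensional space have a common adapted basis
  ([adapted_basis]), so [V_{X_2}] has a basis [e t] whose orders of vanishing at
  [A] and at [B] are [b t] and [b' t], the second ones in some order.  By
  refinedness there are a basis [u t] of [V_{X_1}] and a basis [w t] of [V_{X_3}]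
  with the complementary orders [d - b t] at [A] and [d - b' t] at [B], and since
  the residue field of a point is [k] ([residue_const]) they can be scaled so
  that [u t], [e t], [w t] are glued at the nodes whenever their values there are
  nonzero.  As the orders at each node are distinct, [K i l] is then a direct sum
  over [t] of spaces spanned by combinations of [u t], [e t], [w t]
  ([exists_adapted]).  The summand of [t] is a line, except that it is the plane
  spanned by [(u t, 0, 0)] and [(0, 0, w t)] if [b t < i] and [b' t < l].  Call
  [t] double at [(i, l)] in that case: [K i l] has dimension [r + 1] if and only
  if there is no double index ([has_dim_no_double]).

  Extensions are the same as families of subspaces of dimension [r + 1] of the
  spaces [K i l] that are stable under the maps between them ([extensionE]).  One
  of them always exists and is exact ([std_exact]): in the plane of a double
  index [t] choose the line spanned by [(u t, 0, w t)] on the diagonal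
  [i - b t = l - b' t], by [(u t, 0, 0)] on one side of the diagonal and by
  [(0, 0, w t)] on the other.  So if there is a unique extension, there is a
  unique exact one.

  Counting indices, the dimension condition says that for no [(i, l)] with
  [i + l <= d] a double index coexists with an index [t'] such that [i <= b t']
  and [l <= b' t'] ([no_double_condition]).  Under this condition the extension
  is unique ([model_family_unique]): if there is no double index, the term at
  [(i, l)] is [K i l]; otherwise it is the image of the term at
  [(i - 1, l - 1)].

  If on the contrary a double index [t] coexists with such a [t'], there is a
  second exact extension ([second_family_exists]).  Along the diagonal of [t]
  only the line of [(u t, 0, w t)] has been chosen, so a vector of the index
  [t'] may be altered there by [(u t, 0, 0)] or by [(0, 0, w t)].  Replacing
  [u t'] by [u t' + u t] does this if the diagonal first reaches [i = b t'];
  replacing [w t'] by [w t' + w t] does it if it first reaches [l = b' t']; and if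
  the range [i + l <= d] ends before, altering the family at the end of the
  diagonal is compatible with all the maps. *)

(** * Bases and filtrations of finite-dimensional spaces *)

Definition lin_free (k : fieldType) (E : lmodType k) (n : nat)
    (f : 'I_n -> E) : Prop :=
  forall c : 'I_n -> k, \sum_i c i *: f i = 0 -> forall i, c i = 0.

Definition lin_span (k : fieldType) (E : lmodType k) (n : nat)
    (f : 'I_n -> E) : set E :=
  fun v => exists c : 'I_n -> k, v = \sum_i c i *: f i.

Definition lin_closed (k : fieldType) (E : lmodType k) (V : E -> Prop) : Prop :=
  V 0 /\ forall (c : k) (x y : E), V x -> V y -> V (c *: x + y).

Section LinearAlgebra.

Variables (k : fieldType) (E : lmodType k).
Implicit Types (V : set E) (x y v : E).

Lemma lin_closedD V x y : lin_closed V -> V x -> V y -> V (x + y).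
Proof. by move=> [_ VD] Vx Vy; have := VD 1 x y Vx Vy; rewrite scale1r. Qed.

Lemma lin_closedZ V c x : lin_closed V -> V x -> V (c *: x).
Proof. by move=> [V0 VD] Vx; have := VD c x 0 Vx V0; rewrite addr0. Qed.

Lemma lin_closedB V x y : lin_closed V -> V x -> V y -> V (x - y).
Proof.
move=> VL Vx Vy; apply: lin_closedD => //.
by rewrite -scaleN1r; apply: lin_closedZ.
Qed.

Lemma lin_closed_sum V (I : Type) (s : seq I) (P : pred I) (f : I -> E) :
  lin_closed V -> (forall i, P i -> V (f i)) -> V (\sum_(i <- s | P i) f i).
Proof.
by move=> VL Vf; elim/big_ind: _ => //; [case: VL | move=> *; apply: lin_closedD].
Qed.

Lemma lin_span_closed n (f : 'I_n -> E) : lin_closed (lin_span f).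
Proof.
split=> [|a x y [cx ->] [cy ->]].
  by exists (fun=> 0); rewrite big1 // => i _; rewrite scale0r.
exists (fun i => a * cx i + cy i); rewrite scaler_sumr -big_split /=.
by apply: eq_bigr => i _; rewrite scalerDl scalerA.
Qed.

Lemma mem_lin_span n (f : 'I_n -> E) i : lin_span f (f i).
Proof.
exists (fun j => (j == i)%:R); rewrite (bigD1 i) //= eqxx scale1r big1 ?addr0 //.
by move=> j /negPf->; rewrite scale0r.
Qed.

Lemma lin_span_min n (f : 'I_n -> E) V :
  lin_closed V -> (forall i, V (f i)) -> forall v, lin_span f v -> V v.
Proof.
move=> VL Vf _ [c ->]; apply: lin_closed_sum => // i _; exact: lin_closedZ.
Qed.

Lemma has_dim_span n (f : 'I_n -> E) : lin_free f -> has_dim (lin_span f) n.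
Proof. by exists f; split. Qed.

Lemma has_dim_closed V n : has_dim V n -> lin_closed V.
Proof. by case=> e [_ ->]; apply: lin_span_closed. Qed.

Lemma has_dim_free V n (f : 'I_n -> E) :
  has_dim V n -> lin_free f -> (forall i, V (f i)) -> V = lin_span f.
Proof.
move=> [e [_ Ve]] freef Vf.
have /choice[M fM] : forall i, exists c : 'I_n -> k, f i = \sum_j c j *: e j.
  by move=> i; have := Vf i; rewrite Ve.
pose A := \matrix_(i, j) M i j.
have Aunit : A \in unitmx.
  rewrite -row_free_unit; apply/negPn/negP => Anf.
  move: Anf; rewrite -kermx_eq0 => /rowV0Pn[x /sub_kermxP xA].
  case/negP; apply/eqP/rowP => i; rewrite mxE.
  apply: (freef (fun i => x 0 i)).
  under eq_bigr => j _ do rewrite fM scaler_sumr.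
  rewrite exchange_big big1 // => j _ /=.
  under eq_bigr => l _ do rewrite scalerA.
  rewrite -scaler_suml; have /matrixP/(_ 0 j) := xA; rewrite !mxE => xAj.
  suff -> : \sum_i0 x 0 i0 * M i0 j = 0 by rewrite scale0r.
  by rewrite -[RHS]xAj; apply: eq_bigr => l _; rewrite mxE.
rewrite Ve; apply/seteqP; split=> v.
  apply: (lin_span_min (lin_span_closed f)) => j.
  exists (fun i => invmx A j i).
  under eq_bigr => i _ do rewrite fM scaler_sumr.
  rewrite exchange_big /=.
  under eq_bigr => l _ do (under eq_bigr => i _ do rewrite scalerA;
     rewrite -scaler_suml).
  have AA l : \sum_i invmx A j i * M i l = (j == l)%:R.
    have /matrixP/(_ j l) := mulVmx Aunit; rewrite !mxE => <-.
    by apply: eq_bigr => i _; rewrite mxE.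
  under eq_bigr => l _ do rewrite AA.
  rewrite (bigD1 j) //= eqxx scale1r big1 ?addr0 //.
  by move=> l; rewrite eq_sym => /negPf->; rewrite scale0r.
apply: (lin_span_min (lin_span_closed e)) => i.
by exists (M i).
Qed.

Lemma has_dim_sub V W n : has_dim V n -> has_dim W n -> V `<=` W -> V = W.
Proof.
move=> [e [freee Ve]] Wdim VW; rewrite Ve; apply/esym/has_dim_free => // i.
by apply: VW; rewrite Ve; apply: mem_lin_span.
Qed.

(** [F p] stands for the vectors of order at least [p]; the order of zero is
    infinite. *)
Definition leads (F : nat -> pred E) (p : nat) (v : E) : bool :=
  F p v && ~~ F p.+1 v.

Definition lin_filtration (F : nat -> pred E) : Prop :=
  (forall p, lin_closed (F p)) /\ forall p v, F p.+1 v -> F p v.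

Lemma filtration0 F p : lin_filtration F -> F p 0.
Proof. by move=> FF; case: (FF.1 p). Qed.

Lemma filtrationZ F p (c : k) x : lin_filtration F -> F p x -> F p (c *: x).
Proof. by move=> FF; apply: (lin_closedZ c (FF.1 p)). Qed.

Lemma filtrationD F p x y : lin_filtration F -> F p x -> F p y -> F p (x + y).
Proof. by move=> FF; apply: (lin_closedD (FF.1 p)). Qed.

Lemma filtrationB F p x y : lin_filtration F -> F p x -> F p y -> F p (x - y).
Proof. by move=> FF; apply: (lin_closedB (FF.1 p)). Qed.

Lemma filtration_le F p q v :
  lin_filtration F -> (p <= q)%N -> F q v -> F p v.
Proof.
move=> [_ Fdec] /subnK <-; elim: (q - p)%N => // m IH Fv.
by apply: IH; apply: Fdec.
Qed.

(** Vectors of distinct orders cannot cancel: the term of least order decides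
    the order of a combination. *)
Lemma filtration_comb F n (e : 'I_n -> E) (m : 'I_n -> nat) (c : 'I_n -> k) p :
  lin_filtration F -> injective m -> (forall i, leads F (m i) (e i)) ->
  F p (\sum_i c i *: e i) <-> (forall i, c i != 0 -> (p <= m i)%N).
Proof.
move=> FF m_inj lead_e; split=> [Fs i ci|le_p]; last first.
  apply: (lin_closed_sum (V := fun v => F p v)) => [|i _]; first exact: FF.1.
  have [->|ci] := eqVneq (c i) 0; first by rewrite scale0r; exact: filtration0.
  apply: filtrationZ => //.
  by case/andP: (lead_e i) => Fe _; apply: filtration_le Fe; last exact: le_p.
case: (arg_minnP m (i0 := i) (P := fun i => c i != 0) ci) => j cj min_j.
suff: (p <= m j)%N by move/leq_trans; apply; apply: min_j.
rewrite leqNgt; apply/negP => lt_j.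
case/andP: (lead_e j) => _ /negP; apply.
rewrite -[e j]scale1r -(mulVf cj) -scalerA; apply: filtrationZ => //.
move: Fs; rewrite (bigD1 j) //= => Fs.
rewrite -[c j *: e j](addrK (\sum_(i < n | i != j) c i *: e i)).
apply: filtrationB => //; [exact: filtration_le Fs|].
apply: (lin_closed_sum (V := fun v => F (m j).+1 v)) => [|l lj]; first exact: FF.1.
have [->|cl] := eqVneq (c l) 0; first by rewrite scale0r; exact: filtration0.
apply: filtrationZ => //.
case/andP: (lead_e l) => Fe _; apply: filtration_le Fe => //.
by rewrite ltn_neqAle min_j // andbT; apply: contraNneq lj => /m_inj->.
Qed.

Lemma leads_free F n (e : 'I_n -> E) (m : 'I_n -> nat) :
  lin_filtration F -> injective m -> (forall i, leads F (m i) (e i)) ->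
  lin_free e.
Proof.
move=> FF m_inj lead_e c s0 i; apply/eqP/negPn/negP => ci.
have F0 : F (m i).+1 (\sum_i c i *: e i) by rewrite s0; exact: filtration0.
by have /(_ i ci) := (filtration_comb c _ FF m_inj lead_e).1 F0; rewrite ltnn.
Qed.

Section AdaptedBasis.

Variables (n : nat) (W : set E) (F G : nat -> pred E) (a b : 'I_n -> nat).
Hypotheses (Wdim : has_dim W n) (FF : lin_filtration F) (FG : lin_filtration G).
Hypotheses (a_inc : {homo a : s t / (s < t)%N}) (b_inc : {homo b : s t / (s < t)%N}).
Hypothesis Fa : forall t, exists2 f, W f & leads F (a t) f.
Hypothesis Gb : forall t, exists2 f, W f & leads G (b t) f.

Lemma inc_inj (m : 'I_n -> nat) : {homo m : s t / (s < t)%N} -> injective m.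
Proof.
move=> m_inc s t mst; apply: val_inj.
by case: (ltngtP s t) => // /m_inc; rewrite mst ltnn.
Qed.

Lemma inc_leq (m : 'I_n -> nat) s t :
  {homo m : s t / (s < t)%N} -> (m s <= m t)%N = (s <= t)%N.
Proof.
move=> m_inc; case: (ltngtP s t) => [/m_inc/ltnW//|/m_inc|/val_inj->].
  by rewrite ltnNge => /negPf.
by rewrite leqnn.
Qed.

(** Since [W] has only [n] orders for [G], the quotients of the induced
    filtration are lines, so that the terms of order [b j] of two vectors can
    be made to cancel. *)
Lemma cancel_leading j f g : W f -> W g -> leads G (b j) f -> leads G (b j) g ->
  exists c : k, f - c *: g = 0 \/
    exists2 l : 'I_n, (j < l)%N & leads G (b l) (f - c *: g).
Proof.
move=> Wf Wg lf lg.
have /choice[h hP] : forall t, exists f, W f /\ leads G (b t) f.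
  by move=> t; have [f' ? ?] := Gb t; exists f'.
have lh t := (hP t).2; have b_inj := inc_inj b_inc.
have Wh : W = lin_span h.
  by apply: has_dim_free (leads_free FG b_inj lh) _ => // t; case: (hP t).
move: Wf Wg lf lg; rewrite Wh => -[x ->] [y ->].
move=> /andP[/(filtration_comb _ _ FG b_inj lh) xj _].
move=> /andP[/(filtration_comb _ _ FG b_inj lh) yj ny].
have yj0 : y j != 0.
  apply: contra ny => /eqP yj0; apply/(filtration_comb _ _ FG b_inj lh) => i yi.
  rewrite ltn_neqAle yj // andbT; apply: contraNneq yi => /b_inj <-.
  by rewrite yj0.
exists (x j / y j).
pose z i := x i - x j / y j * y i.
have -> : \sum_i x i *: h i - (x j / y j) *: \sum_i y i *: h i =
          \sum_i z i *: h i.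
  rewrite scaler_sumr -sumrB; apply: eq_bigr => i _.
  by rewrite scalerA -scalerBl.
have zj0 : z j = 0 by rewrite /z divfK // subrr.
have zle i : z i != 0 -> (j < i)%N.
  move=> zi; have: (j <= i)%N.
    rewrite -(inc_leq _ _ b_inc); have [xi|/xj//] := eqVneq (x i) 0.
    apply: yj; apply: contraNneq zi => yi; by rewrite /z xi yi mulr0 subr0.
  rewrite leq_eqVlt => /predU1P[/val_inj ij|//].
  by rewrite -ij zj0 eqxx in zi.
have [i zi|z0] := pickP (fun i => z i != 0); last first.
  left; rewrite big1 // => i _; have /negbFE/eqP-> := z0 i; exact: scale0r.
right; case: (arg_minnP b (i0 := i) (P := fun i => z i != 0) zi) => l zl lmin.
exists l; first exact: zle.
apply/andP; split; first exact/(filtration_comb _ _ FG b_inj lh).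
apply/negP => /(filtration_comb _ _ FG b_inj lh)/(_ l zl).
by rewrite ltnn.
Qed.

Lemma leads_order f : W f -> f != 0 -> exists j, leads G (b j) f.
Proof.
have /choice[h hP] : forall t, exists f, W f /\ leads G (b t) f.
  by move=> t; have [f' ? ?] := Gb t; exists f'.
have lh t := (hP t).2; have b_inj := inc_inj b_inc.
have -> : W = lin_span h.
  by apply: has_dim_free (leads_free FG b_inj lh) _ => // t; case: (hP t).
move=> -[x ->]; have [i xi _|x0 /negP[]] := pickP (fun i => x i != 0); last first.
  apply/eqP; rewrite big1 // => i _; have /negbFE/eqP-> := x0 i.
  exact: scale0r.
case: (arg_minnP b (i0 := i) (P := fun i => x i != 0) xi) => l xl lmin.
exists l; apply/andP; split; first exact/(filtration_comb _ _ FG b_inj lh).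
apply/negP => /(filtration_comb _ _ FG b_inj lh)/(_ l xl).
by rewrite ltnn.
Qed.

(** Two filtrations always have a common adapted basis.  Among the vectors of
    [F]-order [a t] one of maximal [G]-order is taken; if two of them had the
    same [G]-order, subtracting a multiple of the second from the first would
    raise the [G]-order of the first. *)
Lemma adapted_basis : exists (e : 'I_n -> E) (s : 'I_n -> 'I_n),
  [/\ injective s, forall t, leads F (a t) (e t),
      forall t, leads G (b (s t)) (e t) & W = lin_span e].
Proof.
pose P t j := `[< exists f, [/\ W f, leads F (a t) f & leads G (b j) f] >].
have lead_neq0 t f : leads F (a t) f -> f != 0.
  case/andP => _; apply: contra => /eqP->.
  by case: (FF.1 (a t).+1).
have exP t : exists j, P t j.
  have [f Wf lf] := Fa t; have [j lj] := leads_order Wf (lead_neq0 _ _ lf).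
  by exists j; apply/asboolP; exists f.
have /choice[s sP] : forall t, exists j, P t j /\ forall l, P t l -> (l <= j)%N.
  move=> t; have [j Pj] := exP t.
  by case: (arg_maxnP (fun l : 'I_n => val l) Pj) => l Pl lmax; exists l.
have /choice[e eP] : forall t, exists f,
    [/\ W f, leads F (a t) f & leads G (b (s t)) f].
  by move=> t; have [/asboolP] := sP t.
have no_lt (t t' : 'I_n) : (t < t')%N -> s t = s t' -> False.
  move=> lt_t ss; have [Wt Ft Gt] := eP t; have [Wt' Ft' Gt'] := eP t'.
  rewrite -ss in Gt'; have [c Hc] := cancel_leading Wt Wt' Gt Gt'.
  have lF : leads F (a t) (e t - c *: e t').
    have Fe' : F (a t).+1 (e t').
      by case/andP: Ft' => + _; apply: filtration_le => //; apply: a_inc.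
    have Fce' : F (a t).+1 (c *: e t') by apply: filtrationZ => //.
    case/andP: Ft => Ft Ft1; apply/andP; split.
      by apply: filtrationB => //; exact: FF.2.
    apply: contra Ft1 => Fd; rewrite -[e t](subrK (c *: e t')).
    by apply: filtrationD => //.
  case: Hc => [e0|[l lt_l Gl]]; first by have := lead_neq0 _ _ lF; rewrite e0 eqxx.
  have /(sP t).2 : P t l.
    apply/asboolP; exists (e t - c *: e t'); split=> //.
    by apply: lin_closedB => //; [exact: has_dim_closed Wdim | apply: lin_closedZ => //;
      exact: has_dim_closed Wdim].
  by rewrite leqNgt lt_l.
have eF t : leads F (a t) (e t) by case: (eP t).
exists e, s; split=> [t t' ss|//|t|]; last 1 first.
- by apply: has_dim_free (leads_free FF (inc_inj a_inc) eF) _ => // t; case: (eP t).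
- by case: (ltngtP t t') => [/no_lt/(_ ss)|/no_lt/(_ (esym ss))|/val_inj].
- by case: (eP t).
Qed.

End AdaptedBasis.

End LinearAlgebra.

(** * Orders of vanishing at a point of a curve *)

Section Orders.

Variables (k : closedFieldType) (X : curve k) (P : Defs.point X).
Implicit Types (f g h : X) (D : divisor X).

Lemma ord_scale (c : k) f : c != 0 -> f != 0 -> ord P (c *: f) = ord P f.
Proof.
move=> c0 f0; have cA : c%:A != 0 :> X by rewrite scaler_eq0 oner_eq0 orbF.
by rewrite -mulr_algl ordM // ord_const // add0r.
Qed.

Lemma ord1 : ord P 1 = 0.
Proof. by rewrite -[1 in LHS]scale1r ord_const ?oner_eq0. Qed.

Lemma ord_geE f n : f != 0 -> ord_ge P n f = (n <= ord P f).
Proof. by rewrite /ord_ge => /negPf->. Qed.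

Lemma ord_ge0 n : ord_ge P n 0.
Proof. by rewrite /ord_ge eqxx. Qed.

Lemma ord_geW m n f : m <= n -> ord_ge P n f -> ord_ge P m f.
Proof.
rewrite /ord_ge => le_mn /orP[->//|le_n]; by rewrite (le_trans le_mn le_n) orbT.
Qed.

Lemma ord_geD n f g : ord_ge P n f -> ord_ge P n g -> ord_ge P n (f + g).
Proof.
have [->|f0] := eqVneq f 0; first by rewrite add0r.
have [->|g0] := eqVneq g 0; first by rewrite addr0.
have [->|fg0] := eqVneq (f + g) 0; first by rewrite ord_ge0.
rewrite !ord_geE // => le_f le_g; apply: (le_trans _ (ordD P f0 g0 fg0)).
by rewrite le_min le_f le_g.
Qed.

Lemma ord_geZ n (c : k) f : ord_ge P n f -> ord_ge P n (c *: f).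
Proof.
have [->|c0] := eqVneq c 0; first by rewrite scale0r ord_ge0.
have [->|f0] := eqVneq f 0; first by rewrite scaler0.
have cf0 : c *: f != 0 by rewrite scaler_eq0 negb_or c0.
by rewrite !ord_geE // ord_scale.
Qed.

Lemma ord_geM m n f g : ord_ge P m f -> ord_ge P n g -> ord_ge P (m + n) (f * g).
Proof.
have [->|f0] := eqVneq f 0; first by rewrite mul0r !ord_ge0.
have [->|g0] := eqVneq g 0; first by rewrite mulr0 !ord_ge0.
have fg0 : f * g != 0 by rewrite mulf_neq0.
by rewrite !ord_geE // ordM //; apply: lerD.
Qed.

Lemma ord_ge_closed n : lin_closed (fun f => ord_ge P n f).
Proof.
by split=> [|c f g Pf Pg]; [exact: ord_ge0 | apply: ord_geD => //; apply: ord_geZ].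
Qed.

(** The residue field of [P] is [k].  A function [h] of order [0] satisfies a
    polynomial relation with a uniformizer; its coefficient of lowest degree in
    the uniformizer is a polynomial over [k] that vanishes at the residue of
    [h], and it splits because [k] is algebraically closed. *)
Lemma residue_const h : h != 0 -> ord P h = 0 ->
  exists2 c : k, c != 0 & ord_ge P 1 (h - c *: 1).
Proof.
move=> h0 oh; have [t t0 ot] := ord_unif P.
have oh_ge : ord_ge P 0 h by rewrite ord_geE // oh.
have integral (q : {poly k}) : ord_ge P 0 (horner_alg h q).
  elim/poly_ind: q => [|q c IH]; first by rewrite rmorph0 ord_ge0.
  rewrite rmorphD rmorphM /= horner_algX horner_algC.
  apply: ord_geD; first by rewrite -[0]addr0; apply: ord_geM.
  by apply: ord_geZ; rewrite ord_geE ?oner_eq0 ?ord1.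
have tX n : t ^+ n != 0 /\ ord P (t ^+ n) = n%:Z.
  elim: n => [|n [tn on]]; first by rewrite expr0 oner_eq0 ord1.
  by rewrite exprS mulf_neq0 // ordM // ot on -PoszD add1n.
have [_ /(_ h t)[p p0 pt]] := curve_trdeg X.
have [n pn nmin] : exists2 n, p`_n != 0 & forall m, p`_m != 0 -> (n <= m)%N.
  have exn : exists n, p`_n != 0.
    by exists (size p).-1; rewrite -lead_coefE lead_coef_eq0.
  by exists (ex_minn exn); case: ex_minnP.
pose q := p`_n.
have lt_n : (n < size p)%N.
  by rewrite ltnNge; apply: contra pn => /(nth_default 0)->.
have qh : ord_ge P 1 (horner_alg h q).
  have [->|qh0] := eqVneq (horner_alg h q) 0; first exact: ord_ge0.
  suff : ord_ge P (1 + n%:Z) (horner_alg h q * t ^+ n).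
    have [tn0 otn] := tX n.
    by rewrite !ord_geE ?mulf_neq0 // ordM // otn lerD2r.
  have -> : horner_alg h q * t ^+ n =
      - \sum_(i < size p | i != Ordinal lt_n) horner_alg h p`_i * t ^+ i.
    have : \sum_(i < size p) horner_alg h p`_i * t ^+ i = 0.
      rewrite -[RHS]pt (horner_coef_wide _ (size_poly _ _)).
      by apply: eq_bigr => i _; rewrite coef_map_id0 ?rmorph0.
    by rewrite (bigD1 (Ordinal lt_n)) //= => /eqP; rewrite addr_eq0 => /eqP.
  rewrite -scaleN1r; apply: ord_geZ.
  apply: (lin_closed_sum (V := fun f => ord_ge P (1 + n%:Z) f)) => [|i ni].
    exact: ord_ge_closed.
  have [->|pi] := eqVneq p`_i 0; first by rewrite rmorph0 mul0r ord_ge0.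
  have lt_i : (n < i)%N.
    rewrite ltn_neqAle nmin // andbT eq_sym; apply: contraNneq ni => ni.
    exact/eqP/val_inj.
  have [ti0 oti] := tX i.
  rewrite -[1 + _]add0r; apply: ord_geM; first exact: integral.
  by rewrite ord_geE // oti; lia.
have [s qs] := closed_field_poly_normal q.
have [c hc] : exists c : k, ord_ge P 1 (h - c *: 1).
  move: qh; rewrite qs -mul_polyC rmorphM rmorph_prod /= horner_algC mulr_algl.
  have lq : lead_coef q != 0 by rewrite lead_coef_eq0.
  move=> /(ord_geZ (lead_coef q)^-1); rewrite scalerA mulVf // scale1r.
  elim: s {qs} => [|c s IH]; first by rewrite big_nil ord_geE ?oner_eq0 // ord1.
  rewrite big_cons rmorphB /= horner_algX horner_algC.
  have [hc _|hc] := boolP (ord_ge P 1 (h - c *: 1)).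
    by exists c.
  move=> ohc; apply: IH; move: hc ohc; set u := h - _; set v := \prod_(i <- s) _.
  have [->|u0] := eqVneq u 0; first by rewrite ord_ge0.
  have [->|v0] := eqVneq v 0; first by rewrite ord_ge0.
  by rewrite !ord_geE ?mulf_neq0 // ordM //; lia.
exists c => //; apply: contraTneq hc => ->.
by rewrite scale0r subr0 ord_geE // oh.
Qed.

Lemma same_ord_leading f g : f != 0 -> g != 0 -> ord P f = ord P g ->
  exists2 c : k, c != 0 & ord_ge P (1 + ord P g) (f - c *: g).
Proof.
move=> f0 g0 ofg; have fg0 : f / g != 0 by rewrite mulf_neq0 ?invr_eq0.
have /(residue_const fg0)[c c0 hc] : ord P (f / g) = 0.
  by apply: (@addIr _ (ord P g)); rewrite -ordM // divfK // add0r.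
exists c => //.
have -> : f - c *: g = (f / g - c *: 1) * g.
  by rewrite mulrBl divfK // -scalerAl mul1r.
by apply: ord_geM => //; rewrite ord_geE.
Qed.

(** Orders are counted relative to a local generator of [O(D)]. *)
Definition vanishing (D : divisor X) (m : nat) (f : X) : bool :=
  ord_ge P (m%:Z - coeff P D) f.

Lemma vanishing_filtration D : lin_filtration (vanishing D).
Proof.
split=> [p|p f]; first exact: ord_ge_closed.
by apply: ord_geW; lia.
Qed.

Lemma leads_vanishing D m f :
  leads (vanishing D) m f <-> f != 0 /\ ord P f + coeff P D = m%:Z.
Proof.
rewrite /leads /vanishing; have [->|f0] := eqVneq f 0.
  by rewrite !ord_ge0; split=> // -[].
rewrite !ord_geE //; split=> [/andP[]|[_]]; [split=> //|]; lia.
Qed.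

Lemma mem_vanishing_orders D (W : set X) (s : seq nat) n :
  vanishing_orders D W P s -> n \in s <->
  exists2 f, W f & leads (vanishing D) n f.
Proof.
move=> [_ ->]; split=> [[f [Wf f0 fn]]|[f Wf /leads_vanishing[f0 fn]]].
  by exists f => //; apply/leads_vanishing.
by exists f.
Qed.

End Orders.

(** * Exact families of sections spanned by adapted bases *)

Section Restriction.

Variables (k : closedFieldType) (X : chain k).
Implicit Types (s : sections X) (Y : {set 'I_3}).

Lemma section_ext s s' : s.1.1 = s'.1.1 -> s.1.2 = s'.1.2 -> s.2 = s'.2 -> s = s'.
Proof. by case: s => [[x y] z]; case: s' => [[x' y'] z'] /= -> -> ->. Qed.

Lemma sum_section n (c : 'I_n -> k) (f : 'I_n -> sections X) :
  \sum_i c i *: f i =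
  (\sum_i c i *: (f i).1.1, \sum_i c i *: (f i).1.2, \sum_i c i *: (f i).2).
Proof. by apply: section_ext; rewrite /= !raddf_sum. Qed.

Lemma restr_sum Y n (c : 'I_n -> k) (f : 'I_n -> sections X) :
  restr Y (\sum_i c i *: f i) = \sum_i c i *: restr Y (f i).
Proof.
rewrite !sum_section /restr /=; apply: section_ext => /=; case: ifP => // _;
  by rewrite big1 // => i _; rewrite scaler0.
Qed.

Lemma restrC Y s : restr Y (restr (~: Y) s) = 0.
Proof.
by rewrite /restr !inE; apply: section_ext => /=; case: ifP => //= ->.
Qed.

Lemma restrC' Y s : restr (~: Y) (restr Y s) = 0.
Proof. by have := restrC (~: Y) s; rewrite finset.setCK. Qed.

Lemma vanishing_onP (V : set (sections X)) Y s :
  vanishing_on V Y s <-> V s /\ restr Y s = 0.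
Proof.
split=> [[Vs v1 v2 v3]|[Vs sY]].
  split=> //; apply: section_ext => /=; case: ifP => //; by [].
have sY' := sY; move: sY'; rewrite /restr => -[].
by split=> // qY; [move: H | move: H0 | move: H1]; rewrite qY.
Qed.

Definition exact_step (q : 'I_3) (V W : set (sections X)) : Prop :=
  restr (~: [set q]) @` V = vanishing_on W [set q] /\
  restr [set q] @` W = vanishing_on V (~: [set q]).

(** Restricting to [Y] after restricting to [~: Y] gives zero.  Hence each basis
    vector either is carried to the other side, where its image is killed by the
    way back, or is itself an image and is killed; the vectors [f t] of the
    second kind being free, a vector [v] killed by the way back involves only
    images of the first kind. *)
Lemma restr_span_exact Y n (f g : 'I_n -> sections X) : lin_free f ->
  (forall t, restr (~: Y) (f t) = g t \/ restr Y (g t) = f t) ->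
  restr (~: Y) @` lin_span f = vanishing_on (lin_span g) Y.
Proof.
move=> freef fg; apply/seteqP; split=> [_ [_ [c ->] <-]|v].
  apply/vanishing_onP; split; last exact: restrC.
  rewrite restr_sum; apply: lin_closed_sum => [|t _]; first exact: lin_span_closed.
  apply: lin_closedZ; first exact: lin_span_closed.
  case: (fg t) => [->|<-]; first exact: mem_lin_span.
  by rewrite restrC'; case: (lin_span_closed g).
case/vanishing_onP=> -[c ->]; rewrite restr_sum => c0.
pose c' t := if `[< restr (~: Y) (f t) = g t >] then 0 else c t.
have c'0 : forall t, c' t = 0.
  apply: freef; rewrite -[RHS]c0; apply: eq_bigr => t _; rewrite /c'.
  case: asboolP => [<-|fgs]; first by rewrite restrC scaler0 scale0r.
  by case: (fg t) => // ->.
exists (\sum_t c t *: f t); first by exists c.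
rewrite restr_sum; apply: eq_bigr => t _; have := c'0 t; rewrite /c'.
by case: asboolP => [->//|_ ->]; rewrite !scale0r.
Qed.

Lemma exact_step_span q n (f g : 'I_n -> sections X) : lin_free f -> lin_free g ->
  (forall t, restr (~: [set q]) (f t) = g t \/ restr [set q] (g t) = f t) ->
  exact_step q (lin_span f) (lin_span g).
Proof.
move=> freef freeg fg; split; first exact: restr_span_exact.
have := @restr_span_exact (~: finset.set1 q) n g f freeg.
by rewrite finset.setCK; apply=> t; case: (fg t); [right | left].
Qed.

End Restriction.

Section Chain.

Variables (k : closedFieldType) (X : chain k) (d n : nat) (b b' : 'I_n -> nat).

Lemma restr1 x y z : restr [set q1] ((x, y, z) : sections X) = (x, 0, 0).
Proof. by rewrite /restr !inE. Qed.
Lemma restr2 x y z : restr [set q2] ((x, y, z) : sections X) = (0, y, 0).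
Proof. by rewrite /restr !inE. Qed.
Lemma restr3 x y z : restr [set q3] ((x, y, z) : sections X) = (0, 0, z).
Proof. by rewrite /restr !inE. Qed.
Lemma restrC1 x y z : restr (~: [set q1]) ((x, y, z) : sections X) = (0, y, z).
Proof. by rewrite /restr !inE. Qed.
Lemma restrC2 x y z : restr (~: [set q2]) ((x, y, z) : sections X) = (x, 0, z).
Proof. by rewrite /restr !inE. Qed.
Lemma restrC3 x y z : restr (~: [set q3]) ((x, y, z) : sections X) = (x, y, 0).
Proof. by rewrite /restr !inE. Qed.

Lemma node_cases (q : 'I_3) : [\/ q = q1, q = q2 | q = q3].
Proof.
case: q => [[|[|[|//]]] p]; [apply: Or31 | apply: Or32 | apply: Or33];
  exact: val_inj.
Qed.

(** The components of the standard line of the index [t].  From the point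
    [(b t, b' t)] of the plane of the pairs [(i, l)] start three half-lines:
    [i = b t] downwards, [l = b' t] to the left, and the diagonal
    [i - b t = l - b' t] to the upper right.  They cut the plane into one closed
    sector for each component, so that a boundary point has two components and
    the apex has all three. *)
Definition in1 (t : 'I_n) (i l : nat) : bool :=
  (b t <= i)%N && (l + b t <= i + b' t)%N.
Definition in2 (t : 'I_n) (i l : nat) : bool := (i <= b t)%N && (l <= b' t)%N.
Definition in3 (t : 'I_n) (i l : nat) : bool :=
  (b' t <= l)%N && (i + b' t <= l + b t)%N.

Definition std (u : 'I_n -> X1 X) (e : 'I_n -> X2 X) (w : 'I_n -> X3 X)
    (i l : nat) (t : 'I_n) : sections X :=
  (u t *+ in1 t i l, e t *+ in2 t i l, w t *+ in3 t i l).

(** The step of index [q] is parallel to the half-line opposite to the sector of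
    the component [q] and leads away from that sector.  If it ends outside, only
    the component [q] is lost on the way; if it ends inside, it has started in
    the interior, where [q] is the only component. *)
Lemma std_step u e w q i l i' l' t : tilde d q i l i' l' ->
  restr (~: [set q]) (std u e w i l t) = std u e w i' l' t \/
  restr [set q] (std u e w i' l' t) = std u e w i l t.
Proof.
have triple (x1 x2 x3 y1 y2 y3 : bool) :
    x1 = y1 /\ x2 = y2 /\ x3 = y3 ->
    (u t *+ x1, e t *+ x2, w t *+ x3) = (u t *+ y1, e t *+ y2, w t *+ y3).
  by case=> -> [-> ->].
rewrite /tilde => -[_ _]; rewrite /std.
have u0 : 0 = u t *+ false by [].
have e0 : 0 = e t *+ false by [].
have w0 : 0 = w t *+ false by [].
case: (node_cases q) => -> /= [E1 E2].
- rewrite restrC1 restr1 u0 e0 w0.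
  suff [H|H] : (false = in1 t i' l' /\ in2 t i l = in2 t i' l' /\ in3 t i l = in3 t i' l')
     \/ (in1 t i' l' = in1 t i l /\ false = in2 t i l /\ false = in3 t i l).
  + left; exact: triple.
  + right; exact: triple.
  by rewrite /in1 /in2 /in3 E1 E2; clear; lia.
- rewrite restrC2 restr2 u0 e0 w0.
  suff [H|H] : (in1 t i l = in1 t i' l' /\ false = in2 t i' l' /\ in3 t i l = in3 t i' l')
     \/ (false = in1 t i l /\ in2 t i' l' = in2 t i l /\ false = in3 t i l).
  + left; exact: triple.
  + right; exact: triple.
  by rewrite /in1 /in2 /in3 E1 E2; clear; lia.
- rewrite restrC3 restr3 u0 e0 w0.
  suff [H|H] : (in1 t i l = in1 t i' l' /\ in2 t i l = in2 t i' l' /\ false = in3 t i' l')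
     \/ (false = in1 t i l /\ false = in2 t i l /\ in3 t i' l' = in3 t i l).
  + left; exact: triple.
  + right; exact: triple.
  by rewrite /in1 /in2 /in3 E1 E2; clear; lia.
Qed.

Definition coords (u : 'I_n -> X1 X) (e : 'I_n -> X2 X) (w : 'I_n -> X3 X)
    (x y z : 'I_n -> k) : sections X :=
  (\sum_t x t *: u t, \sum_t y t *: e t, \sum_t z t *: w t).

(** The first three clauses are the orders of vanishing imposed on the vectors
    [u t], [e t] and [w t], of orders [d - b t], [(b t, b' t)] and [d - b' t].
    The last two are the gluing conditions: a vector has a nonzero value at the
    node only if its order is the least allowed one. *)
Definition block (t : 'I_n) (i l : nat) (x y z : k) : Prop :=
  [/\ (i < b t)%N -> x = 0, (b t < i)%N || (b' t < l)%N -> y = 0,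
      (l < b' t)%N -> z = 0, b t = i -> x = y & b' t = l -> y = z].

Section Bases.

Variables (u : 'I_n -> X1 X) (e : 'I_n -> X2 X) (w : 'I_n -> X3 X).
Hypotheses (free_u : lin_free u) (free_e : lin_free e) (free_w : lin_free w).

Lemma lin_free_inj (E : lmodType k) (f : 'I_n -> E) (x y : 'I_n -> k) :
  lin_free f -> \sum_t x t *: f t = \sum_t y t *: f t -> forall t, x t = y t.
Proof.
move=> freef exy t; apply/eqP; rewrite -subr_eq0; apply/eqP.
apply: (freef (fun t => x t - y t)).
under eq_bigr => i _ do rewrite scalerBl.
by rewrite sumrB exy subrr.
Qed.

Lemma coords_inj x y z x' y' z' : coords u e w x y z = coords u e w x' y' z' ->
  forall t, [/\ x t = x' t, y t = y' t & z t = z' t].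
Proof.
case=> Ex Ey Ez t.
split; [exact: lin_free_inj Ex t | exact: lin_free_inj Ey t |].
exact: lin_free_inj Ez t.
Qed.

Lemma comb_std c i l : \sum_t c t *: std u e w i l t =
  coords u e w (fun t => c t * (in1 t i l)%:R) (fun t => c t * (in2 t i l)%:R)
    (fun t => c t * (in3 t i l)%:R).
Proof.
rewrite sum_section /coords /=; apply: section_ext => /=; apply: eq_bigr => t _;
  by rewrite -scalerA scaler_nat.
Qed.

Lemma in_some t i l : [|| in1 t i l, in2 t i l | in3 t i l].
Proof. by rewrite /in1 /in2 /in3; clear; lia. Qed.

Lemma std_free i l : lin_free (std u e w i l).
Proof.
move=> c; rewrite comb_std => c0 t.
have : coords u e w (fun t => c t * (in1 t i l)%:R) (fun t => c t * (in2 t i l)%:R)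
    (fun t => c t * (in3 t i l)%:R) = coords u e w (fun=> 0) (fun=> 0) (fun=> 0).
  by rewrite c0 /coords; apply: section_ext; rewrite /= big1 // => j _; rewrite scale0r.
move=> /coords_inj/(_ t)[]; case/or3P: (in_some t i l) => ->; by rewrite mulr1.
Qed.

Lemma coords1 t x y z :
  coords u e w (fun s => x *+ (s == t)) (fun s => y *+ (s == t)) (fun s => z *+ (s == t)) =
  (x *: u t, y *: e t, z *: w t).
Proof.
rewrite /coords; apply: section_ext => /=; rewrite (bigD1 t) //= eqxx big1 ?addr0 //;
  by move=> s /negPf->; rewrite scale0r.
Qed.

End Bases.

(** The indices for which [(u t, 0, 0)] and [(0, 0, w t)] are both admitted
    in the bidegree [(i, l)], independently of each other. *)
Definition double (t : 'I_n) (i l : nat) : bool := (b t < i)%N && (b' t < l)%N.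

(** A triple of bases in which the spaces [K i l] become direct sums of
    contributions of the single indices. *)
Definition adapted (u : 'I_n -> X1 X) (e : 'I_n -> X2 X) (w : 'I_n -> X3 X)
    (K : nat -> nat -> set (sections X)) : Prop :=
  [/\ lin_free u, lin_free e, lin_free w
    & forall i l, (i + l <= d)%N -> forall s, K i l s <->
        exists x y z, s = coords u e w x y z /\
          forall t, block t i l (x t) (y t) (z t)].

Definition model_family (K V : nat -> nat -> set (sections X)) : Prop :=
  (forall i l, (i + l <= d)%N -> V i l `<=` K i l /\ has_dim (V i l) n) /\
  (forall (q : 'I_3) i l i' l', tilde d q i l i' l' ->
     restr (~: [set q]) @` V i l `<=` V i' l' /\
     restr [set q] @` V i' l' `<=` V i l).

Section Adapted.

Variables (u : 'I_n -> X1 X) (e : 'I_n -> X2 X) (w : 'I_n -> X3 X).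
Variable K : nat -> nat -> set (sections X).
Hypothesis adK : adapted u e w K.

Local Notation S := (std u e w).

Lemma adapted_closed i l : (i + l <= d)%N -> lin_closed (K i l).
Proof.
case: adK => _ _ _ KE le_il; split=> [|c s s']; last first.
  move=> /(KE _ _ le_il)[x [y [z [-> B]]]] /(KE _ _ le_il)[x' [y' [z' [-> B']]]].
  apply/KE => //; exists (fun t => c * x t + x' t), (fun t => c * y t + y' t),
    (fun t => c * z t + z' t); split.
    apply: section_ext => /=; rewrite scaler_sumr -big_split; apply: eq_bigr => t _;
      by rewrite scalerDl scalerA.
  move=> t; have [Bx By Bz Bxy Byz] := B t; have [Bx' By' Bz' Bxy' Byz'] := B' t.
  split=> [/[dup]/Bx->/Bx'->|/[dup]/By->/By'->|/[dup]/Bz->/Bz'->||];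
    rewrite ?mulr0 ?addr0 //.
    by move=> /[dup]/Bxy->/Bxy'->.
  by move=> /[dup]/Byz->/Byz'->.
apply/KE => //; exists (fun=> 0), (fun=> 0), (fun=> 0); split=> //.
by apply: section_ext; rewrite /= big1 // => t _; rewrite scale0r.
Qed.

Lemma adapted_single t i l x y z : (i + l <= d)%N -> block t i l x y z ->
  K i l (x *: u t, y *: e t, z *: w t).
Proof.
case: adK => _ _ _ KE le_il B; apply/KE => //.
exists (fun s => x *+ (s == t)), (fun s => y *+ (s == t)), (fun s => z *+ (s == t)).
split=> [|s]; first by rewrite coords1.
case: eqVneq => [->|_]; first by rewrite !mulr1n.
by rewrite !mulr0n.
Qed.

Lemma adapted_std t i l : (i + l <= d)%N -> K i l (S i l t).
Proof.
move=> le_il; have := @adapted_single t i l (in1 t i l)%:R (in2 t i l)%:R (in3 t i l)%:R le_il.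
rewrite !scaler_nat; apply; rewrite /in1 /in2 /in3; split.
- by rewrite ltnNge => /negPf->.
- by case/orP; rewrite ltnNge => /negPf->; rewrite ?andbF.
- by rewrite ltnNge => /negPf->.
- by move=> ->; congr (nat_of_bool _)%:R; lia.
- by move=> ->; congr (nat_of_bool _)%:R; lia.
Qed.

Lemma std_sub_adapted i l : (i + l <= d)%N -> lin_span (S i l) `<=` K i l.
Proof.
move=> le_il; apply: lin_span_min; first exact: adapted_closed.
by move=> t; apply: adapted_std.
Qed.

Lemma adapted_free i l : lin_free (S i l).
Proof. by case: adK => *; apply: std_free. Qed.

Lemma std_exact : is_exact d (fun i l => lin_span (S i l)).
Proof.
move=> q i l i' l' til; apply: exact_step_span; [exact: adapted_free.. |].
by move=> t; apply: std_step.
Qed.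

Lemma exact_model_family V :
  (forall i l, (i + l <= d)%N -> V i l `<=` K i l /\ has_dim (V i l) n) ->
  is_exact d V -> model_family K V.
Proof.
move=> VK exV; split=> // q i l i' l' /exV[-> ->].
by split=> s [].
Qed.

Lemma std_model : model_family K (fun i l => lin_span (S i l)).
Proof.
apply: exact_model_family std_exact => i l le_il; split; first exact: std_sub_adapted.
by apply: has_dim_span; apply: adapted_free.
Qed.

Lemma adapted_left t i l : (i + l <= d)%N -> (b t < i)%N -> K i l (u t, 0, 0).
Proof.
move=> le_il bi; have := @adapted_single t i l 1 0 0 le_il.
by rewrite scale1r !scale0r; apply; split=> //; lia.
Qed.

Lemma adapted_right t i l : (i + l <= d)%N -> (b' t < l)%N -> K i l (0, 0, w t).
Proof.
move=> le_il bl; have := @adapted_single t i l 0 0 1 le_il.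
by rewrite scale1r !scale0r; apply; split=> //; lia.
Qed.

(** Each index contributes at least a line to [K i l], spanned by [S i l t]; the
    contribution is a plane exactly for the double indices, whose components on
    the outer two curves are not glued to each other. *)
Lemma block_line t i l x y z : ~~ double t i l -> block t i l x y z ->
  let c := if in2 t i l then y else if in1 t i l then x else z in
  [/\ x = c * (in1 t i l)%:R, y = c * (in2 t i l)%:R & z = c * (in3 t i l)%:R].
Proof.
rewrite /double => nd [Bx By Bz Bxy Byz].
have := in_some t i l; case E2: (in2 t i l) => /=.
  move=> _; move: E2; rewrite /in2 /in1 /in3 => E2.
  have -> : ((b t <= i) && (l + b t <= i + b' t))%N = (b t == i) by lia.
  have -> : ((b' t <= l) && (i + b' t <= l + b t))%N = (b' t == l) by lia.
  split; rewrite ?mulr1 //.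
    case: eqP => [/Bxy->|ne]; rewrite ?mulr1 ?mulr0 //; apply: Bx; lia.
  case: eqP => [/Byz->|ne]; rewrite ?mulr1 ?mulr0 //; apply: Bz; lia.
have y0 : y = 0 by apply: By; move: E2; rewrite /in2; lia.
case E1: (in1 t i l) => /=.
  move=> _; have -> : in3 t i l = false by move: E1 E2 nd; rewrite /in1 /in2 /in3; lia.
  rewrite mulr1 mulr0; split=> //.
  have [lt|/eqP/esym/Byz<-//] : (l < b' t)%N \/ l == b' t.
    by move: E1 E2 nd; rewrite /in1 /in2; lia.
  exact: Bz.
move=> E3; rewrite E3 mulr1 mulr0; split=> //.
have [lt|/eqP/esym/Bxy->//] : (i < b t)%N \/ i == b t.
  by move: E1 E2 E3 nd; rewrite /in1 /in2 /in3; lia.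
exact: Bx.
Qed.

Lemma adapted_no_double i l : (i + l <= d)%N -> (forall t, ~~ double t i l) ->
  K i l = lin_span (S i l).
Proof.
move=> le_il nd; apply/seteqP; split; last exact: std_sub_adapted.
case: adK => _ _ _ KE s /(KE _ _ le_il)[x [y [z [-> B]]]].
exists (fun t => if in2 t i l then y t else if in1 t i l then x t else z t).
by rewrite comb_std /coords; apply: section_ext => /=; apply: eq_bigr => t _;
  congr (_ *: _); case: (block_line (nd t) (B t)).
Qed.

(** The two halves of a double index only occur together in [S i l] on the
    diagonal of that index. *)
Lemma span_std_single t i l x z : lin_span (S i l) (x *: u t, 0, z *: w t) ->
  exists c, x = c * (in1 t i l)%:R /\ z = c * (in3 t i l)%:R.
Proof.
case: adK => freeu freee freew _ [c]; rewrite -[0](scale0r (e t)) -coords1 comb_std.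
move=> /(coords_inj freeu freee freew)/(_ t)[]; rewrite eqxx !mulr1n => -> _ ->.
by exists (c t).
Qed.

(** If [K i l] has dimension [n], it is the span of the standard lines, which
    never contains both halves of a double index. *)
Lemma has_dim_no_double i l : (i + l <= d)%N ->
  has_dim (K i l) n <-> forall t, ~~ double t i l.
Proof.
move=> le_il; split=> [Kdim t|nd]; last first.
  by rewrite adapted_no_double //; apply: has_dim_span; apply: adapted_free.
apply/negP => /andP[bi bl].
have KS := has_dim_free Kdim (@adapted_free i l) (fun t => adapted_std t le_il).
have left_S : lin_span (S i l) (u t, 0, 0) by rewrite -KS; exact: adapted_left le_il bi.
have right_S : lin_span (S i l) (0, 0, w t) by rewrite -KS; exact: adapted_right le_il bl.
have [c [u1 w0]] : exists c : k, 1 = c * (in1 t i l)%:R /\ 0 = c * (in3 t i l)%:R.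
  by apply: (@span_std_single t i l 1 0); rewrite scale1r scale0r.
have [c' [_ w1]] : exists c : k, 0 = c * (in1 t i l)%:R /\ 1 = c * (in3 t i l)%:R.
  by apply: (@span_std_single t i l 0 1); rewrite scale1r scale0r.
move: u1 w0 w1; case: (in3 t i l); rewrite ?mulr1 ?mulr0; last first.
  by move=> _ _ /eqP; rewrite oner_eq0.
by move=> u1 c0; move: u1; rewrite -c0 mul0r => /eqP; rewrite oner_eq0.
Qed.

End Adapted.

End Chain.

(** * Uniqueness of exact and arbitrary extensions of the model *)

Section Shear.

Variables (k : fieldType) (E : lmodType k) (n : nat) (f : 'I_n -> E).
Variables (t t' : 'I_n) (c : k).
Hypotheses (free_f : lin_free f) (neq_t : t != t').

Definition shear (s : 'I_n) : E := f s + (c *+ (s == t')) *: f t.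

Lemma shear_free : lin_free shear.
Proof.
move=> x x0.
have {}x0 : \sum_s (x s + (x t' * c) *+ (s == t)) *: f s = 0.
  rewrite -[RHS]x0 /shear; under eq_bigr => s _ do rewrite scalerDl.
  under [RHS]eq_bigr => s _ do rewrite scalerDr scalerA.
  rewrite !big_split /=; congr (_ + _).
  rewrite (bigD1 t) //= eqxx big1 => [|s /negPf->]; last by rewrite scale0r.
  rewrite [RHS](bigD1 t') //= eqxx big1 => [|s /negPf->]; last by rewrite mulr0 scale0r.
  by [].
have x0' := free_f x0.
have xt' : x t' = 0 by have := x0' t'; rewrite eq_sym (negPf neq_t) addr0.
by move=> s; have := x0' s; rewrite xt' mul0r mul0rn addr0.
Qed.

Lemma shear_span : lin_span shear = lin_span f.
Proof.
apply/esym/(has_dim_free (has_dim_span free_f) shear_free) => s.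
rewrite /shear; apply: lin_closedD; [exact: lin_span_closed | exact: mem_lin_span |].
by apply: lin_closedZ; [exact: lin_span_closed | exact: mem_lin_span].
Qed.

End Shear.

Section Uniqueness.

Variables (k : closedFieldType) (X : chain k) (d n : nat) (b b' : 'I_n -> nat).
Variables (u : 'I_n -> X1 X) (e : 'I_n -> X2 X) (w : 'I_n -> X3 X).
Variable K : nat -> nat -> set (sections X).
Hypothesis adK : adapted d b b' u e w K.

Local Notation S := (std b b' u e w).

(** Without double indices there is no choice inside [K i l].  With double
    indices, [K i l] contains no section of the middle curve, and then the
    diagonal step from [(i - 1, l - 1)] carries each standard line onto the
    standard line of the same index, so that the previous term of the family
    already fills the term at [(i, l)]. *)
Lemma model_family_unique :
  (forall i l, (i + l <= d)%N ->
     (forall t, ~~ double b b' t i l) \/ (forall t, ~~ in2 b b' t i l)) ->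
  forall V, model_family d n K V ->
  forall i l, (i + l <= d)%N -> V i l = lin_span (S i l).
Proof.
move=> dbl V [VK Vmap]; elim/ltn_ind => i IH l le_il.
have [VKil Vdim] := VK _ _ le_il; have freeS := adapted_free adK (i := i) (l := l).
have [ndbl|[t /andP[bi bl]]] : (forall t, ~~ double b b' t i l) \/
    exists t, double b b' t i l.
- case: (pickP (fun t => double b b' t i l)) => [t|nd]; first by right; exists t.
  by left=> t; rewrite nd.
- rewrite (adapted_no_double adK) // in VKil.
  exact: has_dim_sub Vdim (has_dim_span freeS) VKil.
case: (dbl i l le_il) => [/(_ t)|no2]; first by rewrite /double bi bl.
have til : tilde d q2 i.-1 l.-1 i l by split; rewrite /=; lia.
apply: (has_dim_free Vdim freeS) => s; apply: (Vmap _ _ _ _ _ til).1.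
exists (S i.-1 l.-1 s); last first.
  have H := no2 s; rewrite restrC2 /std; congr (_, _, _).
  - by congr (_ *+ nat_of_bool _); move: H; rewrite /in1 /in2; lia.
  - by rewrite (negPf H).
  - by congr (_ *+ nat_of_bool _); move: H; rewrite /in3 /in2; lia.
rewrite IH; [exact: mem_lin_span | lia | lia].
Qed.

Lemma dims_of_span (f : nat -> nat -> 'I_n -> sections X) :
  (forall i l, (i + l <= d)%N -> lin_free (f i l)) ->
  (forall i l s, (i + l <= d)%N -> K i l (f i l s)) ->
  forall i l, (i + l <= d)%N ->
    lin_span (f i l) `<=` K i l /\ has_dim (lin_span (f i l)) n.
Proof.
move=> freef fK i l le_il; split; last by apply: has_dim_span; apply: freef.
by apply: lin_span_min => [|s]; [exact: adapted_closed adK _ _ le_il | exact: fK].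
Qed.

Definition second_family (V : nat -> nat -> set (sections X)) : Prop :=
  [/\ forall i l, (i + l <= d)%N -> V i l `<=` K i l /\ has_dim (V i l) n,
      is_exact d V
    & exists i l, (i + l <= d)%N /\ V i l <> lin_span (S i l)].

Variables t t' : 'I_n.
Hypotheses (lt_b : (b t < b t')%N) (lt_b' : (b' t < b' t')%N).

Let neq_t : t != t'.
Proof. by apply: contraTneq lt_b => ->; rewrite ltnn. Qed.

(** On its diagonal, the standard line of [t] is spanned by [(u t, 0, w t)] and
    separates neither of its two halves. *)
Lemma diag_not_mem i l (v : sections X) : (b t < i)%N -> (i + b' t = l + b t)%N ->
  v = (u t, 0, 0) \/ v = (0, 0, w t) ->
  forall V : set (sections X), V (S i l t' + v) -> V <> lin_span (S i l).
Proof.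
move=> lt_i diag Ev V Vv VE.
have : lin_span (S i l) v.
  rewrite -[v](addKr (S i l t')) addrC; apply: lin_closedB; first exact: lin_span_closed.
    by rewrite -VE.
  exact: mem_lin_span.
have E1 : in1 b b' t i l by rewrite /in1; lia.
have E3 : in3 b b' t i l by rewrite /in3; lia.
case: Ev => ->.
  rewrite -[u t]scale1r -[0 in X in (_, X)](scale0r (w t)).
  move=> /(span_std_single adK)[c []]; rewrite E1 E3 !mulr1 => <- /eqP.
  by rewrite eq_sym oner_eq0.
rewrite -[w t]scale1r -[X in (X, _, _)](scale0r (u t)).
move=> /(span_std_single adK)[c []]; rewrite E1 E3 !mulr1 => <- /eqP.
by rewrite oner_eq0.
Qed.

(** Replacing [u t'] by [u t' + u t] gives another standard exact family, still
    inside [K i l] because [u t] is admitted wherever [u t'] is.  It differs from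
    the first one on the diagonal of [t], where [(u t, 0, 0)] is admitted but
    does not lie in the span of [S i l], provided that the diagonal reaches
    [i = b t'] before [l] passes [b' t'] and before it leaves the range
    [i + l <= d]. *)
Lemma second_family_left : (b t' + b' t <= b' t' + b t)%N ->
  (b t' + (b' t + (b t' - b t)) <= d)%N -> exists V, second_family V.
Proof.
move=> le_diag feas; have [freeu freee freew _] := adK.
pose u' := shear u t t' 1; have freeu' : lin_free u' := shear_free freeu neq_t.
have E i l s : std b b' u' e w i l s =
    S i l s + (if (s == t') && in1 b b' t' i l then (u t, 0, 0) else 0).
  rewrite /std /u' /shear; apply: section_ext => /=.
  - have [->|_] := eqVneq s t'; last by rewrite /= scale0r !addr0.
    by rewrite mulr1n scale1r mulrnDl; case: (in1 b b' t' i l).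
  - by case: ifP; rewrite addr0.
  - by case: ifP; rewrite addr0.
exists (fun i l => lin_span (std b b' u' e w i l)); split.
- apply: dims_of_span => [i l _|i l s le_il]; first exact: std_free.
  rewrite E; apply: lin_closedD; first exact: adapted_closed adK _ _ le_il.
    by apply: (adapted_std adK).
  case: ifP => [/andP[_ /andP[bi _]]|_].
    by apply: (adapted_left adK) => //; apply: leq_trans bi.
  by case: (adapted_closed adK le_il).
- move=> q i l i' l' til; apply: exact_step_span; [exact: std_free.. |].
  by move=> s; apply: std_step til.
exists (b t'), (b' t + (b t' - b t))%N; split=> //.
have I1 : in1 b b' t' (b t') (b' t + (b t' - b t)) by rewrite /in1; lia.
apply: (@diag_not_mem _ _ (u t, 0, 0)); [by []|lia|by left|].
have <- : std b b' u' e w (b t') (b' t + (b t' - b t)) t' =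
    S (b t') (b' t + (b t' - b t)) t' + (u t, 0, 0) by rewrite E eqxx I1.
exact: mem_lin_span.
Qed.

(** The mirror image, when the diagonal of [t] reaches [l = b' t'] first. *)
Lemma second_family_right : (b' t' + b t <= b t' + b' t)%N ->
  (b t + (b' t' - b' t) + b' t' <= d)%N -> exists V, second_family V.
Proof.
move=> le_diag feas; have [freeu freee freew _] := adK.
pose w' := shear w t t' 1; have freew' : lin_free w' := shear_free freew neq_t.
have E i l s : std b b' u e w' i l s =
    S i l s + (if (s == t') && in3 b b' t' i l then (0, 0, w t) else 0).
  rewrite /std /w' /shear; apply: section_ext => /=.
  - by case: ifP; rewrite addr0.
  - by case: ifP; rewrite addr0.
  - have [->|_] := eqVneq s t'; last by rewrite /= scale0r !addr0.
    by rewrite mulr1n scale1r mulrnDl; case: (in3 b b' t' i l).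
exists (fun i l => lin_span (std b b' u e w' i l)); split.
- apply: dims_of_span => [i l _|i l s le_il]; first exact: std_free.
  rewrite E; apply: lin_closedD; first exact: adapted_closed adK _ _ le_il.
    by apply: (adapted_std adK).
  case: ifP => [/andP[_ /andP[bl _]]|_].
    by apply: (adapted_right adK) => //; apply: leq_trans bl.
  by case: (adapted_closed adK le_il).
- move=> q i l i' l' til; apply: exact_step_span; [exact: std_free.. |].
  by move=> s; apply: std_step til.
exists (b t + (b' t' - b' t))%N, (b' t'); split=> //.
have I3 : in3 b b' t' (b t + (b' t' - b' t)) (b' t') by rewrite /in3; lia.
apply: (@diag_not_mem _ _ (0, 0, w t)); [lia|lia|by right|].
have <- : std b b' u e w' (b t + (b' t' - b' t)) (b' t') t' =
    S (b t + (b' t' - b' t)) (b' t') t' + (0, 0, w t) by rewrite E eqxx I3.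
exact: mem_lin_span.
Qed.


(** When the diagonal of [t] leaves the range [i + l <= d] before it reaches
    [b t'] or [b' t'], no change of basis is visible.  Up to [S i l t], the
    vectors [(u t, 0, 0)] and [(0, 0, - w t)] agree on the diagonal.  One of
    them is added to [S i l t'] at the last point [(i0, l0)] of the diagonal and
    at [(i0, l0.+1)] and [(i0.+1, l0)], because the terms there are mapped into
    the altered term; there it is the vector that the step to [(i0, l0)]
    preserves. *)
Section LastDiagonalPoint.

Variables i0 l0 : nat.
Hypotheses (lt_i0 : (b t < i0)%N) (diag0 : (i0 + b' t = l0 + b t)%N).
Hypotheses (i0_lt : (i0 < b t')%N) (l0_lt : (l0 < b' t')%N).
Hypotheses (feas0 : (i0 + l0 <= d)%N) (last0 : (d < i0 + l0 + 2)%N).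

Definition bump (i l : nat) : sections X :=
  if (i == i0) && ((l == l0) || (l == l0.+1)) then (u t, 0, 0)
  else if (i == i0.+1) && (l == l0) then (0, 0, - w t) else 0.

Definition bumped (i l : nat) (s : 'I_n) : sections X :=
  S i l s + (if s == t' then bump i l else 0).

Lemma bumped_neq i l s : s != t' -> bumped i l s = S i l s.
Proof. by rewrite /bumped => /negPf->; rewrite addr0. Qed.

Lemma bumped_free i l : lin_free (bumped i l).
Proof.
have [freeu freee freew _] := adK.
(* where [bump i l] is nonzero, [S i l t'] has a component on the middle
   curve, which [bump i l] does not change *)
move=> c c0; case E2: (in2 b b' t' i l); last first.
  have : bump i l = 0.
    rewrite /bump; case: ifP => [H|_]; first by move: E2; rewrite /in2; lia.
    by case: ifP => // H; move: E2; rewrite /in2; lia.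
  move=> bump0; apply: (adapted_free adK (i := i) (l := l)); rewrite -[RHS]c0.
  by apply: eq_bigr => s _; rewrite /bumped bump0 if_same addr0.
have ct' : c t' = 0.
  have : \sum_s (c s * (in2 b b' s i l)%:R) *: e s = 0.
    rewrite -[RHS]/((0 : sections X).1.2) -c0 sum_section /=.
    apply: eq_bigr => s _; rewrite -scalerA scaler_nat /bumped /=.
    by case: ifP => _; rewrite /bump; do ?case: ifP => _; rewrite /= addr0.
  by move=> /freee/(_ t'); rewrite E2 mulr1.
apply: (adapted_free adK (i := i) (l := l)); rewrite -[RHS]c0.
apply: eq_bigr => s _; have [->|ne] := eqVneq s t'; first by rewrite ct' !scale0r.
by rewrite bumped_neq.
Qed.

Lemma bumped_K i l s : (i + l <= d)%N -> K i l (bumped i l s).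
Proof.
move=> le_il; have Kc := adapted_closed adK le_il.
apply: lin_closedD => //; first by apply: (adapted_std adK).
case: ifP => _; last by case: Kc.
rewrite /bump; case: ifP => [H|_].
  by apply: (adapted_left adK) => //; lia.
case: ifP => [H|_]; last by case: Kc.
have -> : (0, 0, - w t) = (-1) *: ((0, 0, w t) : sections X).
  by apply: section_ext; rewrite /= ?scaler0 ?scaleN1r.
by apply: lin_closedZ => //; apply: (adapted_right adK) => //; lia.
Qed.

Let bumpL i l := (i == i0) && ((l == l0) || (l == l0.+1)).
Let bumpR i l := (i == i0.+1) && (l == l0).

Let vec (a x y z c : bool) : sections X :=
  (u t' *+ a + u t *+ x, e t' *+ y, w t' *+ z - w t *+ c).

Let bumped_vec i l : bumped i l t' =
  vec (in1 b b' t' i l) (bumpL i l) (in2 b b' t' i l) (in3 b b' t' i l) (bumpR i l).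
Proof.
rewrite /bumped eqxx /bump /vec -/(bumpL i l) -/(bumpR i l).
have [H|_] := boolP (bumpL i l).
  have -> : bumpR i l = false by move: H; rewrite /bumpL /bumpR; lia.
  by apply: section_ext; rewrite /= ?mulr0n ?subr0 ?addr0.
by case: ifP => _; apply: section_ext; rewrite /= ?mulr0n ?subr0 ?addr0.
Qed.

Let restr_vec1 a x y z c : restr [set q1] (vec a x y z c) = vec a x false false false.
Proof. by rewrite /vec restr1 ?addr0 ?subr0. Qed.
Let restr_vec2 a x y z c : restr [set q2] (vec a x y z c) = vec false false y false false.
Proof. by rewrite /vec restr2 ?addr0 ?subr0. Qed.
Let restr_vec3 a x y z c : restr [set q3] (vec a x y z c) = vec false false false z c.
Proof. by rewrite /vec restr3 ?addr0 ?subr0. Qed.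
Let restrC_vec1 a x y z c : restr (~: [set q1]) (vec a x y z c) = vec false false y z c.
Proof. by rewrite /vec restrC1 ?addr0 ?subr0. Qed.
Let restrC_vec2 a x y z c : restr (~: [set q2]) (vec a x y z c) = vec a x false z c.
Proof. by rewrite /vec restrC2 ?addr0 ?subr0. Qed.
Let restrC_vec3 a x y z c : restr (~: [set q3]) (vec a x y z c) = vec a x y false false.
Proof. by rewrite /vec restrC3 ?addr0 ?subr0. Qed.
Let restr_vec := (restr_vec1, restr_vec2, restr_vec3,
  restrC_vec1, restrC_vec2, restrC_vec3).

Let vec_eq a x y z c a' x' y' z' c' :
  a = a' /\ x = x' /\ y = y' /\ z = z' /\ c = c' -> vec a x y z c = vec a' x' y' z' c'.
Proof. by case=> -> [-> [-> [-> ->]]]. Qed.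

(** The change of the basis on the second side of a step that makes it
    compatible with the first. *)
Lemma bumped_step q i l i' l' : tilde d q i l i' l' -> exists c : k,
  restr (~: [set q]) (bumped i l t') = bumped i' l' t' + c *: S i' l' t \/
  restr [set q] (bumped i' l' t' + c *: S i' l' t) = bumped i l t'.
Proof.
move=> [le1 le2]; rewrite !bumped_vec.
have vec0 a x y z c i2 l2 : vec a x y z c + (0 : k) *: S i2 l2 t = vec a x y z c.
  by rewrite scale0r addr0.
case: (node_cases q) => -> /= [E1 E2]; subst; rewrite !restr_vec.
- have [/andP[/eqP-> /eqP->]|ne] := boolP ((i' == i0) && (l == l0)).
    (* [(0, 0, - w t)] is turned into [(u t, 0, 0)] modulo [S i0 l0 t] *)
    exists (-1); left; have -> : S i0 l0 t = (u t, 0, w t).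
      rewrite /std; have [-> [-> ->]] : in1 b b' t i0 l0 = true /\
        in2 b b' t i0 l0 = false /\ in3 b b' t i0 l0 = true.
        by rewrite /in1 /in2 /in3; lia.
      by [].
    transitivity (vec false false true false true).
      by apply: vec_eq; rewrite /in1 /in2 /in3 /bumpL /bumpR; lia.
    transitivity (vec false true true false false +
                  (-1 : k) *: ((u t, 0, w t) : sections X)).
      rewrite /vec; apply: section_ext => /=.
      + by rewrite !mulr0n !mulr1n scaleN1r !add0r subrr.
      + by rewrite scaler0 addr0.
      + by rewrite !mulr0n !mulr1n scaleN1r subr0 add0r.
    congr (_ + _); apply: vec_eq; rewrite /in1 /in2 /in3 /bumpL /bumpR; lia.
  exists 0; rewrite vec0 !restr_vec.
  suff [H|H] :
    (false = in1 b b' t' i' l /\ false = bumpL i' l /\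
      in2 b b' t' i'.+1 l = in2 b b' t' i' l /\
      in3 b b' t' i'.+1 l = in3 b b' t' i' l /\ bumpR i'.+1 l = bumpR i' l) \/
    (in1 b b' t' i' l = in1 b b' t' i'.+1 l /\ bumpL i' l = bumpL i'.+1 l /\
      false = in2 b b' t' i'.+1 l /\ false = in3 b b' t' i'.+1 l /\
      false = bumpR i'.+1 l).
  + by left; apply: vec_eq.
  + by right; apply: vec_eq.
  rewrite /in1 /in2 /in3 /bumpL /bumpR; lia.
- exists 0; rewrite vec0 !restr_vec.
  suff [H|H] :
    (in1 b b' t' i l = in1 b b' t' i.+1 l.+1 /\ bumpL i l = bumpL i.+1 l.+1 /\
      false = in2 b b' t' i.+1 l.+1 /\
      in3 b b' t' i l = in3 b b' t' i.+1 l.+1 /\ bumpR i l = bumpR i.+1 l.+1) \/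
    (false = in1 b b' t' i l /\ false = bumpL i l /\
      in2 b b' t' i.+1 l.+1 = in2 b b' t' i l /\ false = in3 b b' t' i l /\
      false = bumpR i l).
  + by left; apply: vec_eq.
  + by right; apply: vec_eq.
  rewrite /in1 /in2 /in3 /bumpL /bumpR; lia.
have [/andP[/eqP-> /eqP El]|ne] := boolP ((i == i0) && (l'.+1 == l0)).
  (* the added [(u t, 0, 0)] survives and is absorbed by [S i0 l' t] *)
  exists 1; left; have -> : S i0 l' t = (u t, 0, 0).
    rewrite /std; have [-> [-> ->]] : in1 b b' t i0 l' = true /\
      in2 b b' t i0 l' = false /\ in3 b b' t i0 l' = false.
      by rewrite /in1 /in2 /in3; lia.
    by [].
  transitivity (vec false true true false false).
    by apply: vec_eq; rewrite /in1 /in2 /in3 /bumpL /bumpR; lia.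
  transitivity (vec false false true false false + (1 : k) *: ((u t, 0, 0) : sections X)).
    rewrite scale1r /vec; apply: section_ext => /=.
    + by rewrite !mulr0n !mulr1n !add0r.
    + by rewrite addr0.
    + by rewrite !mulr0n subr0 add0r.
  congr (_ + _); apply: vec_eq; rewrite /in1 /in2 /in3 /bumpL /bumpR; lia.
exists 0; rewrite vec0 !restr_vec.
suff [H|H] :
  (in1 b b' t' i l'.+1 = in1 b b' t' i l' /\ bumpL i l'.+1 = bumpL i l' /\
    in2 b b' t' i l'.+1 = in2 b b' t' i l' /\
    false = in3 b b' t' i l' /\ false = bumpR i l') \/
  (false = in1 b b' t' i l'.+1 /\ false = bumpL i l'.+1 /\
    false = in2 b b' t' i l'.+1 /\ in3 b b' t' i l' = in3 b b' t' i l'.+1 /\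
    bumpR i l' = bumpR i l'.+1).
+ by left; apply: vec_eq.
+ by right; apply: vec_eq.
rewrite /in1 /in2 /in3 /bumpL /bumpR; lia.
Qed.

Lemma bumped_exact : is_exact d (fun i l => lin_span (bumped i l)).
Proof.
move=> q i l i' l' til; have [c Hc] := bumped_step til.
rewrite -(shear_span c (@bumped_free i' l') neq_t).
have freeS := shear_free (c := c) (@bumped_free i' l') neq_t.
apply: exact_step_span; [exact: bumped_free | exact: freeS |].
move=> s; rewrite /shear [bumped i' l' t]bumped_neq //.
have [->|ne] := eqVneq s t'; first by rewrite mulr1n.
by rewrite !bumped_neq // mulr0n scale0r addr0; apply: std_step til.
Qed.

Lemma second_family_last : exists V, second_family V.
Proof.
exists (fun i l => lin_span (bumped i l)); split; last 1 first.
- exists i0, l0; split=> //.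
  apply: (@diag_not_mem _ _ (u t, 0, 0)) => //; first by left.
  have <- : bumped i0 l0 t' = S i0 l0 t' + (u t, 0, 0).
    by rewrite /bumped /bump !eqxx.
  exact: mem_lin_span.
- by apply: dims_of_span => [i l _|i l s]; [exact: bumped_free | exact: bumped_K].
exact: bumped_exact.
Qed.

End LastDiagonalPoint.

(** The diagonal of [t] enters the quadrant where [t] is double at a point
    where [t'] is still present on the middle curve.  One of the three previous
    constructions applies according to what happens first along it: [i]
    reaches [b t'], [l] reaches [b' t'], or the range [i + l <= d] ends. *)
Lemma second_family_exists i l : (i + l <= d)%N ->
  double b b' t i l -> in2 b b' t' i l -> exists V, second_family V.
Proof.
move=> le_il /andP[bi bl] /andP[ib lb].
(* [h] steps along the diagonal of [t] from [(b t, b' t)] stay in the range *)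
have [h Eh] : exists h, h = ((d - b t - b' t) %/ 2)%N by exists ((d - b t - b' t) %/ 2)%N.
have [c1|c1] := leqP (b t' - b t) (minn h (b' t' - b' t)).
  by apply: second_family_left; lia.
have [c2|c2] := leqP (b' t' - b' t) (minn h (b t' - b t)).
  by apply: second_family_right; lia.
by apply: (@second_family_last (b t + h) (b' t + h)); lia.
Qed.

End Uniqueness.

(** * Double indices and the numerical form of the dimension condition *)

Section Counting.

Variables (r d : nat) (a a' : r.+1.-tuple nat) (p : 'I_r.+1 -> 'I_r.+1).
Hypotheses (a_sorted : sorted ltn a) (a'_sorted : sorted ltn a') (p_inj : injective p).

Lemma tnth_inc (s : r.+1.-tuple nat) : sorted ltn s ->
  {homo tnth s : i j / (i < j)%N}.
Proof.
move=> s_sorted i j lt_ij; rewrite !(tnth_nth 0%N).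
by apply: (sorted_ltn_nth ltn_trans) => //; rewrite inE size_tuple.
Qed.

Lemma tnth_below (s : r.+1.-tuple nat) i j : sorted ltn s -> (1 <= j <= r)%N ->
  (nth 0%N s j.-1 < i <= nth 0%N s j)%N ->
  forall t : 'I_r.+1, (tnth s t < i)%N = (t < j)%N.
Proof.
move=> s_sorted /andP[j1 jr] /andP[lt_i i_le] t.
have s_inc := tnth_inc s_sorted.
have jr' : (j < r.+1)%N by []; have jr1 : (j.-1 < r.+1)%N by lia.
have E1 : nth 0%N s j = tnth s (Ordinal jr') by rewrite (tnth_nth 0%N).
have E2 : nth 0%N s j.-1 = tnth s (Ordinal jr1) by rewrite (tnth_nth 0%N).
have [tj|jt] := ltnP t j.
  apply: leq_ltn_trans lt_i; rewrite E2 (inc_leq _ _ s_inc) /=; lia.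
apply/negbTE; rewrite -leqNgt; apply: (leq_trans i_le).
by rewrite E1 (inc_leq _ _ s_inc).
Qed.

Lemma exists_index (s : r.+1.-tuple nat) i (t t' : 'I_r.+1) : sorted ltn s ->
  (tnth s t < i)%N -> (i <= tnth s t')%N ->
  exists j, (1 <= j <= r)%N /\ (nth 0%N s j.-1 < i <= nth 0%N s j)%N.
Proof.
move=> s_sorted lt_i i_le; pose j := find (leq i) s.
have has_s : has (leq i) s by apply/hasP; exists (tnth s t'); rewrite ?mem_tnth.
have i_le_j : (i <= nth 0%N s j)%N by apply: (nth_find 0%N has_s).
have before m : (m < j)%N -> (nth 0%N s m < i)%N.
  by move=> /(before_find 0%N) /negbT; rewrite -ltnNge.
have j1 : (0 < j)%N.
  rewrite lt0n; apply/eqP => j0; move: i_le_j; rewrite j0 leqNgt.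
  rewrite (leq_ltn_trans _ lt_i) //.
  by rewrite -[0%N]/(nat_of_ord (@ord0 r)) -tnth_nth (inc_leq _ _ (tnth_inc s_sorted)).
have jr : (j < r.+1)%N by move: has_s; rewrite has_find size_tuple.
exists j; split; first by rewrite j1.
by rewrite i_le_j before // prednK.
Qed.

Local Notation b := (tnth a).
Local Notation b' := (fun t => tnth a' (p t)).

Lemma card_below j : (j <= r.+1)%N -> #|[set t : 'I_r.+1 | (t < j)%N]%SET| = j.
Proof.
move=> jr; rewrite cardE -(size_map val) -[RHS](size_iota 0).
apply/perm_size/uniq_perm; [|exact: iota_uniq|].
  by rewrite map_inj_uniq ?enum_uniq //; apply: val_inj.
move=> x; rewrite mem_iota /=; apply/mapP/idP => [[y + ->]|lt_x].
  by rewrite mem_enum inE.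
have lt_xr : (x < r.+1)%N := leq_trans lt_x jr.
by exists (Ordinal lt_xr); rewrite // mem_enum inE.
Qed.

(** Inclusion-exclusion: [j] indices satisfy [b t < i], [m] indices satisfy
    [b' t < l], the double indices satisfy both and those counted by [in2]
    neither. *)
Lemma double_count i l j m : (1 <= j <= r)%N -> (1 <= m <= r)%N ->
  (nth 0%N a j.-1 < i <= nth 0%N a j)%N ->
  (nth 0%N a' m.-1 < l <= nth 0%N a' m)%N ->
  (#|[set t | double b b' t i l]%SET| + r.+1 = j + m + #|[set t | in2 b b' t i l]%SET|)%N.
Proof.
move=> jr mr Hi Hl.
have Ei := tnth_below a_sorted jr Hi; have El := tnth_below a'_sorted mr Hl.
set D := finset _; set N := finset _.
pose J := [set t : 'I_r.+1 | (t < j)%N]%SET.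
pose M := [set t : 'I_r.+1 | (p t < m)%N]%SET.
have cM : #|M| = m.
  have -> : M = (p @^-1: [set t : 'I_r.+1 | (t < m)%N])%SET.
    by apply/setP => t; rewrite !inE.
  by rewrite on_card_preimset ?card_below //; [lia | apply/onW_bij/injF_bij].
have DE : D = (J :&: M)%SET by apply/setP => t; rewrite !inE /double Ei El.
have NE : N = (~: (J :|: M))%SET.
  by apply/setP => t; rewrite !inE /in2 negb_or -Ei -El -!leqNgt.
have := cardsUI J M; have := cardsC (J :|: M)%SET.
rewrite -NE -DE cM card_below ?card_ord; lia.
Qed.

(** By the count, when [j + m <= r + 1] there are at least as many indices left
    on the middle curve as double ones, so the existence of a double index
    already violates the second condition.  Conversely, if both kinds occur at
    [(i, l)] and [j + m > r + 1], then [i] can be lowered until [j + m = r + 1]: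
    this keeps the indices on the middle curve, and by the count there are then
    as many double indices as those. *)
Lemma no_double_condition :
  (forall i l j m : nat,
      (i + l <= d)%N -> (1 <= j <= r)%N -> (1 <= m <= r)%N ->
      (nth 0%N a j.-1 < i <= nth 0%N a j)%N ->
      (nth 0%N a' m.-1 < l <= nth 0%N a' m)%N ->
      (j + m <= r.+1)%N -> forall t, ~~ double b b' t i l) <->
  (forall i l, (i + l <= d)%N ->
     (forall t, ~~ double b b' t i l) \/ (forall t, ~~ in2 b b' t i l)).
Proof.
split=> [cond i l le_il|cond i l j m le_il jr mr Hi Hl jm t].
  apply: contrapT => /not_orP[/existsNP[t /negP/negPn dt] /existsNP[t' /negP/negPn nt']].
  have /andP[bi bl] := dt; have /andP[ib lb] := nt'.
  have [j [jr Hj]] := exists_index a_sorted bi ib.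
  have [m [mr Hm]] := exists_index a'_sorted bl lb.
  have [jm|jm] := leqP (j + m) r.+1.
    by have := cond i l j m le_il jr mr Hj Hm jm t; rewrite dt.
  pose j2 := (r.+1 - m)%N; pose i2 := (nth 0%N a j2.-1).+1.
  have j2r : (1 <= j2 <= r)%N by rewrite /j2; lia.
  have [le1 Hj2] : (i2 <= i)%N /\ (nth 0%N a j2.-1 < i2 <= nth 0%N a j2)%N.
    have inc x y : (x < y < r.+1)%N -> (nth 0%N a x < nth 0%N a y)%N.
      move=> xy; apply: (sorted_ltn_nth ltn_trans) => //; rewrite ?inE ?size_tuple; lia.
    rewrite /i2 ltnSn inc; last by rewrite /j2; lia.
    split=> //; case/andP: Hj => + _; apply: leq_ltn_trans.
    have [->//|ne] := eqVneq j2.-1 j.-1.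
    by apply/ltnW/inc; move: ne; rewrite /j2; lia.
  have N1 : (0 < #|[set t | in2 b b' t i2 l]%SET|)%N.
    by rewrite card_gt0; apply/set0Pn; exists t'; rewrite inE /in2 lb (leq_trans le1).
  have := double_count j2r mr Hj2 Hm.
  have -> : [set t | double b b' t i2 l]%SET = finset.set0.
    apply/setP => s; rewrite !inE; apply/negbTE.
    apply: (cond i2 l j2 m _ j2r mr Hj2 Hm _ s); last by rewrite /j2; lia.
    exact: leq_trans (leq_add le1 (leqnn l)) le_il.
  by rewrite cards0 /j2; lia.
apply/negP => dt; case: (cond i l le_il) => [/(_ t)|no2]; first by rewrite dt.
have := double_count jr mr Hi Hl.
have -> : [set t | in2 b b' t i l]%SET = finset.set0.
  by apply/setP => s; rewrite !inE; apply/negbTE.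
have D1 : (0 < #|[set t | double b b' t i l]%SET|)%N.
  by rewrite card_gt0; apply/set0Pn; exists t; rewrite inE.
by rewrite cards0; lia.
Qed.

End Counting.

(** * Sections glued at a node *)

Section Gluing.

Variables (k : closedFieldType) (X X' : curve k).
Variables (P : Defs.point X) (P' : Defs.point X').
Variables (D : divisor X) (D' : divisor X') (g : gluing P P' D D').

Lemma glued_high (f : X) (f' : X') :
  ord_ge P (1 - coeff P D) f -> ord_ge P' (1 - coeff P' D') f' -> glued g f f'.
Proof. by move=> of_ of_'; exists 0; rewrite !scale0r !subr0. Qed.

(** Sections with nonzero values at the node can be matched, since these values
    lie in the residue field [k]. *)
Lemma glued_scale (f : X) (f' : X') : f != 0 -> ord P f = - coeff P D ->
  f' != 0 -> ord P' f' = - coeff P' D' ->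
  (exists2 c : k, c != 0 & glued g (c *: f) f') /\
  (exists2 c : k, c != 0 & glued g f (c *: f')).
Proof.
move=> f0 of_ f'0 of_'.
have [c c0 cf] := same_ord_leading f0 (frame_neq0 g) (etrans of_ (esym (frame_ord g))).
have [c' c'0 cf'] := same_ord_leading f'0 (frame'_neq0 g) (etrans of_' (esym (frame'_ord g))).
rewrite frame_ord in cf; rewrite frame'_ord in cf'.
split; [exists (c' / c) | exists (c / c')]; rewrite ?mulf_neq0 ?invr_eq0 //.
  exists c'; split=> //.
  have -> : (c' / c) *: f - c' *: frame g = (c' / c) *: (f - c *: frame g).
    by rewrite scalerBr scalerA divfK.
  exact: ord_geZ.
exists c; split=> //.
have -> : (c / c') *: f' - c *: frame' g = (c / c') *: (f' - c' *: frame' g).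
  by rewrite scalerBr scalerA divfK.
exact: ord_geZ.
Qed.

Lemma glued_leading (f h : X) (f' h' : X') (x y : k) :
  ~~ ord_ge P (1 - coeff P D) f -> glued g f f' ->
  ord_ge P (1 - coeff P D) h -> ord_ge P' (1 - coeff P' D') h' ->
  glued g (x *: f + h) (y *: f' + h') <-> x = y.
Proof.
move=> nf [c [cf cf']] oh oh'.
have c0 : c != 0 by apply: contraNneq nf => c0; move: cf; rewrite c0 scale0r subr0.
have B n (Y : curve k) (Q : Defs.point Y) (f1 f2 : Y) :
    ord_ge Q n f1 -> ord_ge Q n f2 -> ord_ge Q n (f1 - f2).
  by move=> ? ?; rewrite -scaleN1r; apply: ord_geD => //; apply: ord_geZ.
have frame_high (Y : curve k) (Q : Defs.point Y) (DY : divisor Y) (fr f1 h1 : Y)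
    (z c1 : k) :
    fr != 0 -> ord Q fr = - coeff Q DY ->
    ord_ge Q (1 - coeff Q DY) (f1 - c *: fr) -> ord_ge Q (1 - coeff Q DY) h1 ->
    ord_ge Q (1 - coeff Q DY) (z *: f1 + h1 - c1 *: fr) <-> c1 = z * c.
  move=> fr0 ofr of1 oh1.
  have -> : z *: f1 + h1 - c1 *: fr =
      z *: (f1 - c *: fr) + h1 + (z * c - c1) *: fr.
    by rewrite scalerBr scalerA scalerBl !addrA [z *: f1 - _ + h1]addrAC subrK.
  have oz : ord_ge Q (1 - coeff Q DY) (z *: (f1 - c *: fr) + h1).
    by apply: ord_geD => //; apply: ord_geZ.
  split=> [of2|->]; last by rewrite subrr scale0r addr0.
  have := B _ _ _ _ _ of2 oz; rewrite [_ + (_ - _) *: fr]addrC addrK => ofr1.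
  apply/eqP; rewrite eq_sym -subr_eq0; apply: contraTT ofr1 => ne.
  have nz : (z * c - c1) *: fr != 0 by rewrite scaler_eq0 negb_or ne.
  by rewrite ord_geE // ord_scale // ofr -ltNge addrC ltrDl.
split=> [[c1 [c1f c1f']]|<-]; last first.
  exists (x * c); split.
    by apply/(frame_high _ _ _ _ _ _ _ _ (frame_neq0 g) (frame_ord g) cf oh).
  by apply/(frame_high _ _ _ _ _ _ _ _ (frame'_neq0 g) (frame'_ord g) cf' oh').
apply: (mulIf c0).
rewrite -((frame_high _ _ _ _ _ _ _ _ (frame_neq0 g) (frame_ord g) cf oh).1 c1f).
by rewrite -((frame_high _ _ _ _ _ _ _ _ (frame'_neq0 g) (frame'_ord g) cf' oh').1 c1f').
Qed.

(** For vectors of distinct orders on both sides, only the terms that do not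
    vanish at the node enter the gluing condition. *)
Lemma glued_comb n (f : 'I_n -> X) (f' : 'I_n -> X') (m m' : 'I_n -> nat)
    (m0 m0' : nat) (D0 : divisor X) (D0' : divisor X') (x y : 'I_n -> k) :
  m0%:Z - coeff P D0 = - coeff P D -> m0'%:Z - coeff P' D0' = - coeff P' D' ->
  injective m -> (forall t, leads (vanishing P D0) (m t) (f t)) ->
  (forall t, leads (vanishing P' D0') (m' t) (f' t)) ->
  (forall t, m t = m0 <-> m' t = m0') ->
  (forall t, m t = m0 -> glued g (f t) (f' t)) ->
  (forall t, x t != 0 -> (m0 <= m t)%N) -> (forall t, y t != 0 -> (m0' <= m' t)%N) ->
  glued g (\sum_t x t *: f t) (\sum_t y t *: f' t) <->
  (forall t, m t = m0 -> x t = y t).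
Proof.
move=> E0 E0' m_inj lf lf' mm' gl hx hy.
have V1 h : vanishing P D0 m0.+1 h = ord_ge P (1 - coeff P D) h.
  by rewrite /vanishing -E0; congr ord_ge; lia.
have V1' h : vanishing P' D0' m0'.+1 h = ord_ge P' (1 - coeff P' D') h.
  by rewrite /vanishing -E0'; congr ord_ge; lia.
have high t : m t <> m0 -> vanishing P D0 m0.+1 (x t *: f t).
  move=> ne; have [->|x0] := eqVneq (x t) 0; first by rewrite scale0r /vanishing ord_ge0.
  apply: ord_geZ; case/andP: (lf t) => + _.
  by apply: (filtration_le (vanishing_filtration P D0)); have := hx t x0; lia.
have high' t : m t <> m0 -> vanishing P' D0' m0'.+1 (y t *: f' t).
  move=> ne; have [->|y0] := eqVneq (y t) 0; first by rewrite scale0r /vanishing ord_ge0.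
  apply: ord_geZ; case/andP: (lf' t) => + _.
  apply: (filtration_le (vanishing_filtration P' D0')); have := hy t y0.
  by have : m' t <> m0' by [move/mm']; lia.
case: (pickP (fun t => m t == m0)) => [t0 /eqP mt0|none]; last first.
  split=> [_ t mt|_]; first by have := none t; rewrite mt eqxx.
  apply: glued_high.
    rewrite -V1; apply: (lin_closed_sum (V := fun h => vanishing P D0 m0.+1 h)) => [|t _].
      exact: (vanishing_filtration P D0).1.
    by apply: high => mt; have := none t; rewrite mt eqxx.
  rewrite -V1'; apply: (lin_closed_sum (V := fun h => vanishing P' D0' m0'.+1 h)) => [|t _].
    exact: (vanishing_filtration P' D0').1.
  by apply: high' => mt; have := none t; rewrite mt eqxx.
rewrite (bigD1 t0) //= [\sum_t y t *: _](bigD1 t0) //=.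
have ne t : t != t0 -> m t <> m0.
  by move=> /eqP tt0 mt; apply: tt0; apply: m_inj; rewrite mt mt0.
rewrite glued_leading.
- split=> [xy t mt|]; last by apply.
  by have -> : t = t0 by apply: m_inj; rewrite mt mt0.
- by rewrite -V1 -mt0; case/andP: (lf t0).
- exact: gl.
- rewrite -V1; apply: (lin_closed_sum (V := fun h => vanishing P D0 m0.+1 h)) => [|t /ne].
    exact: (vanishing_filtration P D0).1.
  exact: high.
rewrite -V1'; apply: (lin_closed_sum (V := fun h => vanishing P' D0' m0'.+1 h)) => [|t /ne].
  exact: (vanishing_filtration P' D0').1.
exact: high'.
Qed.

End Gluing.

(** * Adapted bases of the three linear series *)

Lemma has_dim_image (k : fieldType) (E E' : lmodType k) (f : E -> E') (V : set E)
    (n : nat) :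
  (forall (c : 'I_n -> k) (v : 'I_n -> E),
     f (\sum_i c i *: v i) = \sum_i c i *: f (v i)) ->
  (forall v, V v -> f v = 0 -> v = 0) -> has_dim V n -> has_dim (f @` V) n.
Proof.
move=> f_sum f_inj [e [freee Ve]]; exists (fun i => f (e i)); split.
  move=> c c0; apply: freee; apply: f_inj; last by rewrite f_sum.
  by rewrite Ve; exists c.
apply/seteqP; split=> [_ [v Vv <-]|_ [c ->]].
  by move: Vv; rewrite Ve => -[c ->]; exists c; rewrite f_sum.
by exists (\sum_i c i *: e i); rewrite ?f_sum // Ve; exists c.
Qed.

Section Data.

Variables (k : closedFieldType) (X : chain k) (d r : nat).
Variables (L : line_bundle X) (Lt : nat -> nat -> line_bundle X).
Variables (V1 V2 V3 : set (sections X)) (a b b' c : r.+1.-tuple nat).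
Hypotheses (twists : is_twist_family d L Lt) (data : is_data d r Lt V1 V2 V3).
Hypothesis refined : is_refined d Lt V1 V2 V3 a b b' c.

Local Notation D1 := (div1 (Lt d 0%N)).
Local Notation D2 := (div2 (Lt 0%N 0%N)).
Local Notation D3 := (div3 (Lt 0%N d)).
Local Notation K := (Kspace d Lt V1 V2 V3).

Lemma coeff_div1 i l P : (i + l <= d)%N ->
  coeff P (div1 (Lt i l)) = coeff P D1 - (d - i)%N%:Z * (A1 X == P)%:R.
Proof.
case: twists => LtL LtD _ _ le_il; case: (LtD i l le_il) => -> _ _.
by rewrite coeffB coeffU LtL.
Qed.

Lemma coeff_div2 i l P : (i + l <= d)%N ->
  coeff P (div2 (Lt i l)) =
  coeff P D2 - i%:Z * (A2 X == P)%:R - l%:Z * (B2 X == P)%:R.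
Proof.
case: twists => LtL LtD _ _ le_il; case: (LtD i l le_il) => _ -> _.
case: (LtD 0%N 0%N isT) => _ -> _; rewrite !coeffB !coeffD !coeffU.
by case: (A2 X == P); case: (B2 X == P) => /=; lia.
Qed.

Lemma coeff_div3 i l P : (i + l <= d)%N ->
  coeff P (div3 (Lt i l)) = coeff P D3 - (d - l)%N%:Z * (B3 X == P)%:R.
Proof.
case: twists => LtL LtD _ _ le_il; case: (LtD i l le_il) => _ _ ->.
have le0 : (0 + d <= d)%N by [].
case: (LtD 0%N d le0) => _ _ ->; rewrite !coeffD !coeffU.
by case: (B3 X == P) => /=; lia.
Qed.

Lemma series1_H0 f : series1 V1 f -> H0 D1 f.
Proof. by case: data => [[V1H _ _] _ _ _] [s /V1H[? _ _ _ _] <-]. Qed.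
Lemma series2_H0 f : series2 V2 f -> H0 D2 f.
Proof. by case: data => [[_ V2H _] _ _ _] [s /V2H[_ ? _ _ _] <-]. Qed.
Lemma series3_H0 f : series3 V3 f -> H0 D3 f.
Proof. by case: data => [[_ _ V3H] _ _ _] [s /V3H[_ _ ? _ _] <-]. Qed.

Lemma H0_div1 i l f : (i + l <= d)%N -> H0 D1 f ->
  H0 (div1 (Lt i l)) f <-> vanishing (A1 X) D1 (d - i) f.
Proof.
move=> le_il Hf; split=> [/(_ (A1 X))|Hv P].
  by rewrite (coeff_div1 _ le_il) eqxx mulr1 /vanishing opprB.
rewrite (coeff_div1 _ le_il); case: (eqVneq (A1 X) P) => [<-|_].
  by rewrite mulr1 opprB.
by rewrite mulr0 subr0; apply: Hf.
Qed.

Lemma H0_div2 i l f : (i + l <= d)%N -> H0 D2 f ->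
  H0 (div2 (Lt i l)) f <-> vanishing (A2 X) D2 i f /\ vanishing (B2 X) D2 l f.
Proof.
have neqAB : (A2 X == B2 X) = false by apply/eqP; apply: A2_neq_B2.
move=> le_il Hf; split=> [Hs|[HA HB] P].
  have := Hs (A2 X); have := Hs (B2 X); rewrite !(coeff_div2 _ le_il) !eqxx neqAB.
  by rewrite eq_sym neqAB !mulr1 !mulr0 !subr0 /vanishing !opprB.
rewrite (coeff_div2 _ le_il); case: (eqVneq (A2 X) P) => [<-|_].
  by rewrite eq_sym neqAB mulr1 mulr0 subr0 opprB.
case: (eqVneq (B2 X) P) => [<-|_].
  by rewrite mulr1 mulr0 subr0 opprB.
by rewrite !mulr0 !subr0; apply: Hf.
Qed.

Lemma H0_div3 i l f : (i + l <= d)%N -> H0 D3 f ->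
  H0 (div3 (Lt i l)) f <-> vanishing (B3 X) D3 (d - l) f.
Proof.
move=> le_il Hf; split=> [/(_ (B3 X))|Hv P].
  by rewrite (coeff_div3 _ le_il) eqxx mulr1 /vanishing opprB.
rewrite (coeff_div3 _ le_il); case: (eqVneq (B3 X) P) => [<-|_].
  by rewrite mulr1 opprB.
by rewrite mulr0 subr0; apply: Hf.
Qed.

Lemma KspaceP i l s : (i + l <= d)%N -> K i l s <->
  [/\ H0X (Lt i l) s, series1 V1 s.1.1, series2 V2 s.1.2 & series3 V3 s.2].
Proof.
move=> le_il; split=> [[Hs [W1 _] [W2 _] [W3 _]]//|[Hs W1 W2 W3]].
have [H1 H2 H3 _ _] := Hs.
split=> //; split=> // P.
- by rewrite coeffB coeffU -(coeff_div1 _ le_il); apply: H1.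
- have := H2 P; rewrite (coeff_div2 _ le_il) coeffB coeffD !coeffU.
  by rewrite -(addrA (coeff P D2)) -opprD.
- by rewrite coeffB coeffU -(coeff_div3 _ le_il); apply: H3.
Qed.

Lemma series_dim : [/\ has_dim (series1 V1) r.+1, has_dim (series2 V2) r.+1
  & has_dim (series3 V3) r.+1].
Proof.
case: data => _ [d1 d2 d3] _ [i1 i2 i3]; split; apply: has_dim_image => //.
- by move=> x v; rewrite sum_section.
- by move=> s Vs s0; apply: i1; split=> //; rewrite !inE.
- by move=> x v; rewrite sum_section.
- by move=> s Vs s0; apply: i2; split=> //; rewrite !inE.
- by move=> x v; rewrite sum_section.
- by move=> s Vs s0; apply: i3; split=> //; rewrite !inE.
Qed.

(** The basis [e] of the middle series is adapted to both nodes.  Refinedness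
    provides in the outer series vectors of the complementary orders, and these
    are rescaled so that [u t] and [e t] are glued at [A] when [i = b t], and
    [e t] and [w t] at [B] when [l] is the order of [e t] at [B]. *)
Lemma exists_adapted : exists (p : 'I_r.+1 -> 'I_r.+1) u e w,
  injective p /\ adapted d (tnth b) (fun t => tnth b' (p t)) u e w K.
Proof.
have [dim1 dim2 dim3] := series_dim.
have [o1 oA oB o3 ref] := refined.
have b_inc := tnth_inc oA.1; have b'_inc := tnth_inc oB.1.
have [e [p [p_inj eA eB We]]] : exists (e : 'I_r.+1 -> X2 X) (s : 'I_r.+1 -> 'I_r.+1),
    [/\ injective s, forall t, leads (vanishing (A2 X) D2) (tnth b t) (e t),
      forall t, leads (vanishing (B2 X) D2) (tnth b' (s t)) (e t)
      & series2 V2 = lin_span e].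
  apply: (adapted_basis dim2) => // [||t|t]; try exact: vanishing_filtration.
    by apply/(mem_vanishing_orders _ oA); apply: mem_tnth.
  by apply/(mem_vanishing_orders _ oB); apply: mem_tnth.
pose b2 t := tnth b' (p t).
have b_le t : (tnth b t <= d)%N by have [<- _] := ref t; apply: leq_addl.
have b2_le t : (b2 t <= d)%N by have [_ <-] := ref (p t); apply: leq_addr.
have b2_inj : injective b2 by apply: inj_comp p_inj; apply: inc_inj.
have lead_ord (Y : curve k) (Q : Defs.point Y) (D D' : divisor Y) (m : nat) f :
    leads (vanishing Q D) m f -> m%:Z - coeff Q D = - coeff Q D' ->
    f != 0 /\ ord Q f = - coeff Q D'.
  by move=> /leads_vanishing[f0 of_] <-; split=> //; rewrite -of_ addrK.
have leads_scale (Y : curve k) (Q : Defs.point Y) (D : divisor Y) (m : nat) (x : k) f :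
    x != 0 -> leads (vanishing Q D) m f -> leads (vanishing Q D) m (x *: f).
  move=> x0 /leads_vanishing[f0 of_]; apply/leads_vanishing.
  by rewrite scaler_eq0 negb_or x0 f0 ord_scale.
have neqAB : (A2 X == B2 X) = false by apply/eqP; apply: A2_neq_B2.
have neqBA : (B2 X == A2 X) = false by rewrite eq_sym.
have cA1 i l : (i + l <= d)%N ->
    (d - i)%N%:Z - coeff (A1 X) D1 = - coeff (A1 X) (div1 (Lt i l)).
  by move=> le_il; rewrite (coeff_div1 _ le_il) eqxx mulr1 opprB.
have cA2 i l : (i + l <= d)%N -> i%:Z - coeff (A2 X) D2 = - coeff (A2 X) (div2 (Lt i l)).
  by move=> le_il; rewrite (coeff_div2 _ le_il) eqxx neqBA mulr1 mulr0 subr0 opprB.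
have cB2 i l : (i + l <= d)%N -> l%:Z - coeff (B2 X) D2 = - coeff (B2 X) (div2 (Lt i l)).
  by move=> le_il; rewrite (coeff_div2 _ le_il) eqxx neqAB mulr1 mulr0 subr0 opprB.
have cB3 i l : (i + l <= d)%N ->
    (d - l)%N%:Z - coeff (B3 X) D3 = - coeff (B3 X) (div3 (Lt i l)).
  by move=> le_il; rewrite (coeff_div3 _ le_il) eqxx mulr1 opprB.
have /choice[u uP] : forall t, exists f, [/\ series1 V1 f,
    leads (vanishing (A1 X) D1) (d - tnth b t) f
    & glued (glueA (Lt (tnth b t) 0%N)) f (e t)].
  move=> t; have feas : (tnth b t + 0 <= d)%N by rewrite addn0.
  have : (d - tnth b t)%N \in a.
    by have [<- _] := ref t; rewrite addnK; apply: mem_tnth.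
  move=> /(mem_vanishing_orders _ o1)[f Wf lf].
  have [f0 of_] := lead_ord _ _ _ _ _ _ lf (cA1 _ _ feas).
  have [e0 oe] := lead_ord _ _ _ _ _ _ (eA t) (cA2 _ _ feas).
  have [[x x0 gx] _] := glued_scale (glueA (Lt (tnth b t) 0%N)) f0 of_ e0 oe.
  exists (x *: f); split=> //; last exact: leads_scale.
  by apply: lin_closedZ => //; apply: has_dim_closed dim1.
have /choice[w wP] : forall t, exists f, [/\ series3 V3 f,
    leads (vanishing (B3 X) D3) (d - b2 t) f
    & glued (glueB (Lt 0%N (b2 t))) (e t) f].
  move=> t; have feas : (0 + b2 t <= d)%N by exact: b2_le.
  have : (d - b2 t)%N \in c.
    by have [_ <-] := ref (p t); rewrite /b2 addKn; apply: mem_tnth.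
  move=> /(mem_vanishing_orders _ o3)[f Wf lf].
  have [f0 of_] := lead_ord _ _ _ _ _ _ lf (cB3 _ _ feas).
  have [e0 oe] := lead_ord _ _ _ _ _ _ (eB t) (cB2 _ _ feas).
  have [_ [x x0 gx]] := glued_scale (glueB (Lt 0%N (b2 t))) e0 oe f0 of_.
  exists (x *: f); split=> //; last exact: leads_scale.
  by apply: lin_closedZ => //; apply: has_dim_closed dim3.
have lu t : leads (vanishing (A1 X) D1) (d - tnth b t) (u t) by case: (uP t).
have lw t : leads (vanishing (B3 X) D3) (d - b2 t) (w t) by case: (wP t).
have db_inj : injective (fun t => d - tnth b t)%N.
  move=> s t Est; apply: (inc_inj b_inc); have := b_le s; have := b_le t; lia.
have db2_inj : injective (fun t => d - b2 t)%N.
  move=> s t Est; apply: b2_inj; have := b2_le s; have := b2_le t; lia.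
have F1 := vanishing_filtration (A1 X) D1; have F3 := vanishing_filtration (B3 X) D3.
have FA := vanishing_filtration (A2 X) D2; have FB := vanishing_filtration (B2 X) D2.
have freeu : lin_free u := leads_free F1 db_inj lu.
have freew : lin_free w := leads_free F3 db2_inj lw.
have freee : lin_free e := leads_free FA (inc_inj b_inc) eA.
have W1 : series1 V1 = lin_span u.
  by apply: has_dim_free => // t; case: (uP t).
have W3 : series3 V3 = lin_span w.
  by apply: has_dim_free => // t; case: (wP t).
exists p, u, e, w; split=> //; split=> // i l le_il s.
have le_i0 : (i + 0 <= d)%N by lia.
have le_0l : (0 + l <= d)%N by lia.
have [_ _ twA twB] := twists.
have cond x y z : K i l (coords u e w x y z) <->
    [/\ forall t, x t != 0 -> (d - i <= d - tnth b t)%N,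
        forall t, y t != 0 -> (i <= tnth b t)%N,
        forall t, y t != 0 -> (l <= b2 t)%N,
        forall t, z t != 0 -> (d - l <= d - b2 t)%N
      & glued (glueA (Lt i 0%N)) (\sum_t x t *: u t) (\sum_t y t *: e t) /\
        glued (glueB (Lt 0%N l)) (\sum_t y t *: e t) (\sum_t z t *: w t)].
  have S1 : series1 V1 (\sum_t x t *: u t) by rewrite W1; exists x.
  have S2 : series2 V2 (\sum_t y t *: e t) by rewrite We; exists y.
  have S3 : series3 V3 (\sum_t z t *: w t) by rewrite W3; exists z.
  rewrite KspaceP //.
  have h1 := H0_div1 le_il (series1_H0 S1); have h2 := H0_div2 le_il (series2_H0 S2).
  have h3 := H0_div3 le_il (series3_H0 S3).
  have f1 := filtration_comb x (d - i) F1 db_inj lu.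
  have fA := filtration_comb y i FA (inc_inj b_inc) eA.
  have fB := filtration_comb y l FB b2_inj eB.
  have f3 := filtration_comb z (d - l) F3 db2_inj lw.
  have gA := twA i l 0%N le_il le_i0 (\sum_t x t *: u t) (\sum_t y t *: e t).
  have gB := twB i 0%N l le_il le_0l (\sum_t y t *: e t) (\sum_t z t *: w t).
  split=> [[[/= H1 H2 H3 HA HB] _ _ _]|[x_le y_le y_le' z_le [HA HB]]].
    have /h2[vA vB] := H2.
    by split; [apply/f1/h1|apply/fA|apply/fB|apply/f3/h3|split; [apply/gA|apply/gB]].
  split=> //; split=> /=; [exact/h1/f1| |exact/h3/f3|exact/gA|exact/gB].
  by apply/h2; split; [apply/fA|apply/fB].
have blocks x y z : K i l (coords u e w x y z) <->
    forall t, block (tnth b) b2 t i l (x t) (y t) (z t).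
  rewrite cond.
  have gA : (forall t, x t != 0 -> (d - i <= d - tnth b t)%N) ->
      (forall t, y t != 0 -> (i <= tnth b t)%N) ->
      glued (glueA (Lt i 0%N)) (\sum_t x t *: u t) (\sum_t y t *: e t) <->
      (forall t, (d - tnth b t)%N = (d - i)%N -> x t = y t).
    apply: glued_comb (cA1 _ _ le_i0) (cA2 _ _ le_i0) db_inj lu eA _ _ => t.
      by have := b_le t; lia.
    by move=> Et; have -> : i = tnth b t by [have := b_le t; lia]; case: (uP t).
  have gB : (forall t, y t != 0 -> (l <= b2 t)%N) ->
      (forall t, z t != 0 -> (d - l <= d - b2 t)%N) ->
      glued (glueB (Lt 0%N l)) (\sum_t y t *: e t) (\sum_t z t *: w t) <->
      (forall t, b2 t = l -> y t = z t).
    apply: glued_comb (cB2 _ _ le_0l) (cB3 _ _ le_0l) b2_inj eB lw _ _ => t.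
      by have := b2_le t; lia.
    by move=> <-; case: (wP t).
  have contra0 (v : k) (P : bool) : (v != 0 -> P) -> ~~ P -> v = 0.
    by move=> vP; apply: contraNeq.
  split=> [[x_le y_le y_le' z_le [/(gA x_le y_le) HA /(gB y_le' z_le) HB]] t|B].
    have bt := b_le t; have b2t := b2_le t; split.
    - by move=> lt; apply: contra0 (x_le t) _; lia.
    - by case/orP=> lt; [apply: contra0 (y_le t) _|apply: contra0 (y_le' t) _]; lia.
    - by move=> lt; apply: contra0 (z_le t) _; lia.
    - by move=> Et; apply: HA; rewrite Et.
    - exact: HB.
  have x_le t : x t != 0 -> (d - i <= d - tnth b t)%N.
    case: (B t) => Bx _ _ _ _ x0; apply: leq_sub2l; rewrite leqNgt.
    by apply: contra x0 => /Bx->.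
  have y_le t : y t != 0 -> (i <= tnth b t)%N.
    case: (B t) => _ By _ _ _; rewrite leqNgt; apply: contra => lt.
    by rewrite By ?lt.
  have y_le' t : y t != 0 -> (l <= b2 t)%N.
    case: (B t) => _ By _ _ _; rewrite leqNgt; apply: contra => lt.
    by rewrite By ?lt ?orbT.
  have z_le t : z t != 0 -> (d - l <= d - b2 t)%N.
    case: (B t) => _ _ Bz _ _ z0; apply: leq_sub2l; rewrite leqNgt.
    by apply: contra z0 => /Bz->.
  split=> //; split.
    apply/(gA x_le y_le) => t Et; case: (B t) => _ _ _ + _; apply.
    by have := b_le t; lia.
  by apply/(gB y_le' z_le) => t; case: (B t).
split=> [Ks|[x [y [z [-> /blocks//]]]]].
have : K i l s := Ks; rewrite KspaceP // W1 We W3 => -[_ [x Ex] [y Ey] [z Ez]].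
exists x, y, z; have Es : s = coords u e w x y z by apply: section_ext.
by split=> //; apply/blocks; rewrite -Es.
Qed.

End Data.

(** * Extensions as families inside the spaces [K i l] *)

Section Extensions.

Variables (k : closedFieldType) (X : chain k) (d r : nat).
Variables (L : line_bundle X) (Lt : nat -> nat -> line_bundle X).
Variables (V1 V2 V3 : set (sections X)).
Hypotheses (twists : is_twist_family d L Lt) (data : is_data d r Lt V1 V2 V3).

Local Notation K := (Kspace d Lt V1 V2 V3).

Lemma iter_restr (Y : {set 'I_3}) m (s : sections X) :
  [/\ q1 \in Y -> (iter m (restr Y) s).1.1 = s.1.1,
      q2 \in Y -> (iter m (restr Y) s).1.2 = s.1.2
    & q3 \in Y -> (iter m (restr Y) s).2 = s.2].
Proof.
elim: m => [//|m [I1 I2 I3]]; split=> qY; rewrite iterS {1}/restr /= qY;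
  [exact: I1 | exact: I2 | exact: I3].
Qed.

(** The linking maps do not change the components they keep, so they carry the
    remaining components of a section of [V_{X_q}] into the other two series. *)
Lemma data_sub_K : [/\ V1 `<=` K d 0%N, V2 `<=` K 0%N 0%N & V3 `<=` K 0%N d].
Proof.
have [[H1 H2 H3] _ [L12 L21 L23 L32] _] := data.
have in12 s : V1 s -> exists2 s', V2 s' & s'.1.2 = s.1.2 /\ s'.2 = s.2.
  move=> Vs; exists (iter d (restr (~: [set q1])) s); first by apply: L12; exists s.
  have [_ e2 e3] := iter_restr (~: [set q1]) d s.
  by split; [apply: e2 | apply: e3]; rewrite !inE.
have in21 s : V2 s -> exists2 s', V1 s' & s'.1.1 = s.1.1.
  move=> Vs; exists (iter d (restr [set q1]) s); first by apply: L21; exists s.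
  by have [-> //] := iter_restr [set q1]%SET d s; rewrite ?inE.
have in23 s : V2 s -> exists2 s', V3 s' & s'.2 = s.2.
  move=> Vs; exists (iter d (restr [set q3]) s); first by apply: L23; exists s.
  by have [_ _ -> //] := iter_restr [set q3]%SET d s; rewrite ?inE.
have in32 s : V3 s -> exists2 s', V2 s' & s'.1.2 = s.1.2 /\ s'.1.1 = s.1.1.
  move=> Vs; exists (iter d (restr (~: [set q3])) s); first by apply: L32; exists s.
  have [e1 e2 _] := iter_restr (~: [set q3]) d s.
  by split; [apply: e2 | apply: e1]; rewrite !inE.
split=> s Vs; apply/(KspaceP _ _ _ twists); rewrite ?addn0 //.
- have [s2 V2s [e2 e3]] := in12 _ Vs; have [s3 V3s e3'] := in23 _ V2s.
  by split; [exact: H1|exists s|exists s2|exists s3; rewrite ?e3'].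
- have [s1 V1s e1] := in21 _ Vs; have [s3 V3s e3] := in23 _ Vs.
  by split; [exact: H2|exists s1|exists s|exists s3].
have [s2 V2s [e2 e1]] := in32 _ Vs; have [s1 V1s e1'] := in21 _ V2s.
by split; [exact: H3|exists s1; rewrite ?e1'|exists s2|exists s].
Qed.

Section Transport.

Variable V : nat -> nat -> set (sections X).
Hypothesis Vmap : forall (q : 'I_3) (i l i' l' : nat), tilde d q i l i' l' ->
  restr (~: [set q]) @` V i l `<=` V i' l' /\ restr [set q] @` V i' l' `<=` V i l.

Lemma lower_l i l s : (i + l <= d)%N -> V i l s ->
  exists2 s', V i 0%N s' & s'.1.1 = s.1.1 /\ s'.1.2 = s.1.2.
Proof.
elim: l s => [|l IH] s le_il Vs; first by exists s.
have til : tilde d q3 i l.+1 i l by split; rewrite //=; lia.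
have /IH[|s' Vs' [e1 e2]] : V i l (restr (~: [set q3]) s).
- by apply: (Vmap til).1; exists s.
- lia.
by exists s' => //; rewrite e1 e2 /restr !inE.
Qed.

Lemma lower_i i l s : (i + l <= d)%N -> V i l s ->
  exists2 s', V 0%N l s' & s'.1.2 = s.1.2 /\ s'.2 = s.2.
Proof.
elim: i s => [|i IH] s le_il Vs; first by exists s.
have til : tilde d q1 i.+1 l i l by split; rewrite //=; lia.
have /IH[|s' Vs' [e1 e2]] : V i l (restr (~: [set q1]) s).
- by apply: (Vmap til).1; exists s.
- lia.
by exists s' => //; rewrite e1 e2 /restr !inE.
Qed.

Lemma raise_i i s : (i <= d)%N -> V i 0%N s -> exists2 s', V d 0%N s' & s'.1.1 = s.1.1.
Proof.
move=> le_i; have [m Em] : exists m, (d - i)%N = m by exists (d - i)%N.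
elim: m i s le_i Em => [|m IH] i s le_i Em Vs.
  by exists s => //; have -> : d = i by lia.
have til : tilde d q1 i.+1 0 i 0 by split; rewrite //=; lia.
have /IH[||s' Vs' e1] : V i.+1 0%N (restr [set q1] s).
- by apply: (Vmap til).2; exists s.
- lia.
- lia.
by exists s' => //; rewrite e1 /restr !inE.
Qed.

Lemma raise_l l s : (l <= d)%N -> V 0%N l s -> exists2 s', V 0%N d s' & s'.2 = s.2.
Proof.
move=> le_l; have [m Em] : exists m, (d - l)%N = m by exists (d - l)%N.
elim: m l s le_l Em => [|m IH] l s le_l Em Vs.
  by exists s => //; have -> : d = l by lia.
have til : tilde d q3 0 l.+1 0 l by split; rewrite //=; lia.
have /IH[||s' Vs' e1] : V 0%N l.+1 (restr [set q3] s).
- by apply: (Vmap til).2; exists s.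
- lia.
- lia.
by exists s' => //; rewrite e1 /restr !inE.
Qed.

End Transport.

(** A section of an extension can be transported to each of the three extreme
    multidegrees without changing the component on which that multidegree is
    concentrated, so its components lie in the three series.  Conversely, there
    are no double indices in the extreme multidegrees, hence [K i l] has
    dimension [r + 1] there, which forces the extreme terms of the family. *)
Lemma extensionE b b' u e w : adapted (n := r.+1) d b b' u e w K ->
  forall V, is_extension d r Lt V1 V2 V3 V <-> model_family d r.+1 K V.
Proof.
move=> adK V; split=> [[[VH Vmap] [E1 E2 E3]]|[VK Vmap]].
  split=> // i l le_il; have [VHil Vdim] := VH _ _ le_il; split=> // s Vs.
  have [s0 V0 [e01 e02]] := lower_l Vmap le_il Vs.
  have le_i0 : (i + 0 <= d)%N by lia.
  apply/(KspaceP _ _ _ twists) => //; split; first exact: VHil.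
  - have [|s1 V1s e1] := raise_i Vmap _ V0; first by lia.
    by exists s1; rewrite -?E1 // e1.
  - have [s2 V2s [e2 _]] := lower_i Vmap le_i0 V0.
    by exists s2; rewrite -?E2 // e2.
  have [s2 V2s [_ e3]] := lower_i Vmap le_il Vs.
  have [|s3 V3s e3'] := raise_l Vmap _ V2s; first by lia.
  by exists s3; rewrite -?E3 // e3' e3.
split.
  split=> // i l le_il; have [VKil Vdim] := VK _ _ le_il; split=> // s /VKil.
  by case.
have [s1 s2 s3] := data_sub_K; have [_ [d1 d2 d3] _ _] := data.
have corner i l W : (i + l <= d)%N -> (i = 0%N \/ l = 0%N) -> has_dim W r.+1 ->
    W `<=` K i l -> V i l = W.
  move=> le_il il0 Wdim WK; have [VKil Vdim] := VK _ _ le_il.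
  have Kdim : has_dim (K i l) r.+1.
    apply/(has_dim_no_double adK le_il) => t; rewrite /double.
    by case: il0 => ->; rewrite ltn0 // andbF.
  by rewrite (has_dim_sub Vdim Kdim VKil) (has_dim_sub Wdim Kdim WK).
by split; apply: corner; rewrite ?addn0 //; [right | left | left].
Qed.

End Extensions.

(** * The equivalences *)

Theorem theorem5p3 (k : closedFieldType) (X : chain k) (d r : nat)
    (L : line_bundle X) (Lt : nat -> nat -> line_bundle X)
    (V1 V2 V3 : set (sections X)) (a b b' c : r.+1.-tuple nat)
    (degL1 : deg (div1 L) = d%:Z) (degL2 : deg (div2 L) = 0)
    (degL3 : deg (div3 L) = 0)
    (twists : is_twist_family d L Lt)
    (data : is_data d r Lt V1 V2 V3)
    (refined : is_refined d Lt V1 V2 V3 a b b' c) :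
  let unique_exact_extension :=
    exists_unique_family d (is_exact_extension d r Lt V1 V2 V3) in
  let dim_condition :=
    forall i l j m : nat,
      (i + l <= d)%N -> (1 <= j <= r)%N -> (1 <= m <= r)%N ->
      (nth 0%N b j.-1 < i <= nth 0%N b j)%N ->
      (nth 0%N b' m.-1 < l <= nth 0%N b' m)%N ->
      (j + m <= r.+1)%N ->
      has_dim (Kspace d Lt V1 V2 V3 i l) r.+1 in
  let unique_extension :=
    exists_unique_family d (is_extension d r Lt V1 V2 V3) in
  (unique_exact_extension <-> dim_condition) /\
  (dim_condition <-> unique_extension).
Proof.
move=> unique_exact_extension dim_condition unique_extension.
have [p [u [e [w [p_inj adK]]]]] := exists_adapted twists data refined.
have [_ [b_sorted _] [b'_sorted _] _ _] := refined.
have extE := extensionE twists data adK.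
pose Std i l := lin_span (std (tnth b) (fun t => tnth b' (p t)) u e w i l).
have std_ext : is_extension d r Lt V1 V2 V3 Std by apply/extE; exact: std_model adK.
have std_exact_ext : is_exact_extension d r Lt V1 V2 V3 Std.
  by split=> //; exact: std_exact adK.
have dimE : dim_condition <-> forall i l, (i + l <= d)%N ->
    (forall t, ~~ double (tnth b) (fun t => tnth b' (p t)) t i l) \/
    (forall t, ~~ in2 (tnth b) (fun t => tnth b' (p t)) t i l).
  rewrite -no_double_condition // /dim_condition.
  split=> cond i l j m le_il jr mr Hi Hl jm.
    by apply/(has_dim_no_double adK le_il); apply: cond jm.
  by apply/(has_dim_no_double adK le_il); apply: cond jm.
have exact_dim : unique_exact_extension -> dim_condition.
  move=> [V [_ Vuniq]]; apply/dimE => i l le_il.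
  apply: contrapT => /not_orP[/existsNP[t /negP/negPn dt] /existsNP[t' /negP/negPn nt']].
  have lt_b : (tnth b t < tnth b t')%N.
    by case/andP: dt => bi _; case/andP: nt' => ib _; apply: leq_trans bi ib.
  have lt_b' : (tnth b' (p t) < tnth b' (p t'))%N.
    by case/andP: dt => _ bl; case/andP: nt' => _ lb; apply: leq_trans bl lb.
  have [V' [V'K V'exact [i0 [l0 [le0 neq0]]]]] :=
    second_family_exists adK lt_b lt_b' le_il dt nt'.
  apply: neq0; rewrite -/(Std i0 l0) (Vuniq _ std_exact_ext) //; apply: Vuniq => //.
  by split=> //; apply/extE; apply: exact_model_family.
have dim_unique : dim_condition -> unique_extension.
  move/dimE => cond; exists Std; split=> // V' /extE V'model i l le_il.
  exact: model_family_unique adK cond V' V'model i l le_il.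
have unique_exact : unique_extension -> unique_exact_extension.
  move=> [V [_ Vuniq]]; exists Std; split=> // V' [V'ext _] i l le_il.
  by rewrite (Vuniq _ V'ext) // (Vuniq _ std_ext).
split; split=> //; first by move/dim_unique/unique_exact.
by move/unique_exact/exact_dim.
Qed.
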